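(* Let $|q|<1$ and let $k\geq 5$ be an integer. Then \[ \sum_{m_1,\dots,m_{k-2}\geq 0} \frac{q^{(m_1+m_2)^2+m_2^2+m_3^2+\cdots+m_{k-2}^2}}{(q)_{m_1}(q)_{2m_2}} \Bigl(\prod_{j=3}^{k-3}\begin{bmatrix}m_{j-1}+m_j-m_{j+1}\\ 2m_j\end{bmatrix}\Bigr) \begin{bmatrix}m_{k-3}\\ m_{k-2}\end{bmatrix} =\frac{(q^{F_kF_{k-2}},q^{F_kF_{k-2}+1},q^{2F_kF_{k-2}+1};q^{2F_kF_{k-2}+1})_{\infty}}{(q;q)_{\infty}}. \]
   Context: $F_k$ denotes the Fibonacci numbers: $F_0=0$, $F_1=1$, $F_k=F_{k-1}+F_{k-2}$. $(x;q)_n=\prod_{i=0}^{n-1}(1-xq^i)$ (with $n=\infty$ allowed), $(q)_n=(q;q)_n$, and $(x_1,\dots,x_r;q)_\infty=\prod_{i=1}^r(x_i;q)_\infty$. The $q$-binomial coefficient is $\begin{bmatrix}n\\ m\end{bmatrix}=\frac{(q)_n}{(q)_m(q)_{n-m}}$ if $m$ and $n-m$ are nonnegative integers and $0$ otherwise. An empty product equals $1$. *)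

(* Defs.v *)
From Stdlib Require Import Reals List Lia ZArith.
From Coquelicot Require Import Coquelicot.
Import ListNotations.
Open Scope C_scope.

Fixpoint fib (n : nat) : nat :=
  match n with
  | O => O
  | S n' => match n' with O => 1%nat | S n'' => (fib n' + fib n'')%nat end
  end.

Fixpoint cpow (x : C) (n : nat) : C :=
  match n with O => 1 | S n => x * cpow x n end.

Fixpoint qpoch (x q : C) (n : nat) : C :=
  match n with O => 1 | S n => qpoch x q n * (1 - x * cpow q n) end.

Definition qfac (q : C) (n : nat) : C := qpoch q q n.

Definition qbin (q : C) (n : Z) (m : nat) : C :=
  if Z.leb (Z.of_nat m) n
  then qfac q (Z.to_nat n) / (qfac q m * qfac q (Z.to_nat n - m))
  else 0.

Definition csum (l : list C) : C := fold_right Cplus 0 l.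
Definition cprod (l : list C) : C := fold_right Cmult 1 l.

Fixpoint tuples (d N : nat) : list (list nat) :=
  match d with
  | O => [nil]
  | S d => flat_map (fun l => map (fun i => i :: l) (seq 0 N)) (tuples d N)
  end.

Definition lhs_term (k : nat) (q : C) (l : list nat) : C :=
  let r := (k - 2)%nat in
  let m := fun j : nat => nth (j - 1) l 0%nat in
  cpow q ((m 1%nat + m 2%nat) ^ 2
          + fold_right Nat.add 0%nat (map (fun j => m j ^ 2) (seq 2 (r - 1))))%nat
  / (qfac q (m 1%nat) * qfac q (2 * m 2%nat))
  * cprod (map (fun j => qbin q (Z.of_nat (m (j - 1)%nat) + Z.of_nat (m j)
                                 - Z.of_nat (m (j + 1)%nat))%Z (2 * m j))
               (seq 3 (r - 3)))
  * qbin q (Z.of_nat (m (r - 1)%nat)) (m r).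

Definition lhs_box (k : nat) (q : C) (N : nat) : C :=
  csum (map (lhs_term k q) (tuples (k - 2) N)).

Definition rhs_partial (k : nat) (q : C) (n : nat) : C :=
  let a := (fib k * fib (k - 2))%nat in
  let Q := cpow q (2 * a + 1) in
  qpoch (cpow q a) Q n * qpoch (cpow q (a + 1)) Q n
  * qpoch (cpow q (2 * a + 1)) Q n / qpoch q q n.

(* Main.v *)
(* Write B(L,M,a,b) = [L+M+a-b; L+a] [L+M-a+b; L-a].  The Burge transform
     sum_i q^(i^2) [2L+M-i; 2L] B(L-i,i,a,b) = q^(b^2) B(L,M,a+b,b),
   a form of the q-Saalschutz sum, combined with B(L,M,a,b) = B(M,L,b,a), acts on (a,b) by
   (a,b) -> (b,a+b).  The innermost q-binomial expands, by a limit of q-Dixon, as an alternating sum of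
   B(L,M,j,j); summing out m_(k-2), ..., m_3 therefore replaces (j,j) by multiples of consecutive
   Fibonacci numbers, and leaves two Bailey-type sums over m_1 and m_2 that evaluate to
   q^(2 r^2)/(q;q)_infinity with r = j F_(k-2).  What remains is the theta series
   sum_(j in Z) (-1)^j q^(j(j-1)/2 + j^2 F_k F_(k-2)), which is the product by the Jacobi triple product. *)
Require Import Defs.
From Stdlib Require Import Reals List Lia ZArith Lra.
From Coquelicot Require Import Coquelicot.
Open Scope C_scope.

(** The obstacle is convergence: the left side is a limit over boxes m_i < N, and no infinite
    multiple sum is ever rearranged. The q-binomials vanish unless m_2 >= m_3 >= ... >= m_(k-2), so
    a box truncates only the sums over m_1 and m_2, and eliminating the other variables is an exact
    identity for each N. The square m_1, m_2 < N is then compared with the triangle m_1 + m_2 < N,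
    on which the first of the two Bailey sums is a finite identity. Limits are taken only after
    that, by dominated convergence with geometric bounds. Both sides are shown to tend to T/P, where
    T is the theta series and P = (q;q)_infinity is nonzero. The finite sums rest on Wilf-Zeilberger
    certificates: a first-order recurrence holds for the summand up to a telescoping difference,
    which [ring] can check once all truncated subtractions are removed. *)

(** * Finite sums, powers and q-factorials *)

Fixpoint sumC (f : nat -> C) (n : nat) : C :=
  match n with O => 0 | S n => sumC f n + f n end.

Lemma sumC_ext (f g : nat -> C) n :
  (forall i, (i < n)%nat -> f i = g i) -> sumC f n = sumC g n.
Proof.
  induction n as [|n IH]; intros H; simpl; [easy|].
  rewrite IH by (intros; apply H; lia). now rewrite (H n) by lia.
Qed.

Lemma sumC_zero (f : nat -> C) n : (forall i, (i < n)%nat -> f i = 0) -> sumC f n = 0.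
Proof.
  induction n as [|n IH]; intros H; simpl; [easy|].
  rewrite IH by (intros; apply H; lia). rewrite (H n) by lia. ring.
Qed.

Lemma sumC_plus f g n : sumC (fun i => f i + g i) n = sumC f n + sumC g n.
Proof. induction n as [|n IH]; simpl; [ring|]. rewrite IH. ring. Qed.

Lemma sumC_scal c f n : sumC (fun i => c * f i) n = c * sumC f n.
Proof. induction n as [|n IH]; simpl; [ring|]. rewrite IH. ring. Qed.

Lemma sumC_minus f g n : sumC (fun i => f i - g i) n = sumC f n - sumC g n.
Proof. induction n as [|n IH]; simpl; [ring|]. rewrite IH. ring. Qed.

Lemma sumC_swap (f : nat -> nat -> C) m n :
  sumC (fun i => sumC (f i) n) m = sumC (fun j => sumC (fun i => f i j) m) n.
Proof.
  induction m as [|m IH]; simpl.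
  - symmetry. now apply sumC_zero.
  - rewrite IH, <- sumC_plus. reflexivity.
Qed.

Lemma sumC_telescope g n : sumC (fun i => g (S i) - g i) n = g n - g O.
Proof. induction n as [|n IH]; simpl; [ring|]. rewrite IH. ring. Qed.

Lemma sumC_add (f : nat -> C) m n : sumC f (m + n) = sumC f m + sumC (fun i => f (m + i)%nat) n.
Proof.
  induction n as [|n IH].
  - rewrite Nat.add_0_r. simpl. ring.
  - rewrite Nat.add_succ_r. simpl. rewrite IH. ring.
Qed.

Lemma sumC_pad (f : nat -> C) m n :
  (m <= n)%nat -> (forall i, (m <= i)%nat -> f i = 0) -> sumC f n = sumC f m.
Proof.
  intros Hmn H. replace n with (m + (n - m))%nat by lia.
  rewrite sumC_add, (sumC_zero (fun i => f (m + i)%nat)); [ring|].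
  intros; apply H; lia.
Qed.

Lemma sumC_first (f : nat -> C) n :
  (0 < n)%nat -> (forall i, (0 < i)%nat -> f i = 0) -> sumC f n = f O.
Proof.
  intros Hn H. rewrite (sumC_pad f 1 n) by (auto; lia). simpl. ring.
Qed.

Lemma sumC_shift (f : nat -> C) r n :
  (r <= n)%nat -> (forall i, (i < r)%nat -> f i = 0) ->
  sumC f n = sumC (fun s => f (r + s)%nat) (n - r).
Proof.
  intros Hr H. replace n with (r + (n - r))%nat at 1 by lia.
  rewrite sumC_add, (sumC_zero f r); [ring|easy].
Qed.

Lemma cpow_add x m n : cpow x (m + n) = cpow x m * cpow x n.
Proof. induction m as [|m IH]; simpl; [ring|]. rewrite IH. ring. Qed.

Lemma cpow_mul x m n : cpow x (m * n) = cpow (cpow x m) n.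
Proof.
  induction n as [|n IH].
  - now rewrite Nat.mul_0_r.
  - replace (m * S n)%nat with (m + m * n)%nat by lia. now rewrite cpow_add, IH.
Qed.

Lemma cpow_1 n : cpow 1 n = 1.
Proof. induction n as [|n IH]; simpl; [easy|]. rewrite IH. ring. Qed.

Lemma Cmod_cpow x n : Cmod (cpow x n) = (Cmod x ^ n)%R.
Proof.
  induction n as [|n IH]; simpl; [apply Cmod_1|]. now rewrite Cmod_mult, IH.
Qed.

Lemma qfac_S q n : qfac q (S n) = qfac q n * (1 - cpow q (S n)).
Proof. reflexivity. Qed.

Lemma one_minus_cpow_neq q n : (Cmod q < 1)%R -> 1 - cpow q (S n) <> 0.
Proof.
  intros Hq H.
  assert (E : cpow q (S n) = 1) by (transitivity (1 - (1 - cpow q (S n))); [ring|rewrite H; ring]).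
  apply (f_equal Cmod) in E. rewrite Cmod_cpow, Cmod_1 in E.
  assert (Cmod q ^ S n < 1)%R; [|lra].
  apply pow_lt_1_compat; [split; [apply Cmod_ge_0|easy]|lia].
Qed.

Lemma qfac_neq q n : (Cmod q < 1)%R -> qfac q n <> 0.
Proof.
  intros Hq. induction n as [|n IH].
  - apply C1_nz.
  - rewrite qfac_S. apply Cmult_neq_0; [easy|]. now apply one_minus_cpow_neq.
Qed.

(* 1/(q)_(n-j), set to 0 for j > n: sums over j then terminate by themselves, and the recurrences
   [rqfac_step] and [rqfac_pred] hold without side conditions on j. *)
Definition rqfac (q : C) (n j : nat) : C :=
  if Nat.leb j n then / qfac q (n - j) else 0.

Lemma rqfac_out q n j : (n < j)%nat -> rqfac q n j = 0.
Proof. intros H. unfold rqfac. now rewrite (proj2 (Nat.leb_gt j n)). Qed.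

Lemma rqfac_in q n j : (j <= n)%nat -> rqfac q n j = / qfac q (n - j).
Proof. intros H. unfold rqfac. now rewrite (proj2 (Nat.leb_le j n)). Qed.

Lemma rqfac_0 q n : rqfac q n 0 = / qfac q n.
Proof. rewrite rqfac_in by lia. now rewrite Nat.sub_0_r. Qed.

(** Only the integer n - i matters, negative values included, so both arguments can be shifted
    without a case distinction. *)
Lemma rqfac_eq q n m i j :
  (n + j = m + i)%nat -> rqfac q n i = rqfac q m j.
Proof.
  intros H. destruct (le_lt_dec i n) as [Hi|Hi].
  - rewrite !rqfac_in by lia. do 2 f_equal. lia.
  - now rewrite !rqfac_out by lia.
Qed.

Lemma rqfac_step q n j :
  (Cmod q < 1)%R -> rqfac q n (S j) = (1 - cpow q (n - j)) * rqfac q n j.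
Proof.
  intros Hq. destruct (lt_eq_lt_dec n j) as [[H|H]|H].
  - rewrite !rqfac_out by lia. ring.
  - subst. rewrite rqfac_out by lia. rewrite Nat.sub_diag. simpl. ring.
  - rewrite !rqfac_in by lia. replace (n - j)%nat with (S (n - S j)) by lia.
    rewrite qfac_S. field. split; auto using one_minus_cpow_neq, qfac_neq.
Qed.

Lemma rqfac_pred q n j :
  (Cmod q < 1)%R -> rqfac q n j = (1 - cpow q (S n - j)) * rqfac q (S n) j.
Proof.
  intros Hq. rewrite <- rqfac_step by easy. apply rqfac_eq. lia.
Qed.

Lemma inv_qfac_S q n :
  (Cmod q < 1)%R -> (1 - cpow q (S n)) * / qfac q (S n) = / qfac q n.
Proof.
  intros Hq. rewrite qfac_S. field.
  split; auto using one_minus_cpow_neq, qfac_neq.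
Qed.

Lemma Cmult_reg_l (c x y : C) : c <> 0 -> c * x = c * y -> x = y.
Proof.
  intros Hc H. transitivity (/ c * (c * x)); [field; easy|]. rewrite H. field; easy.
Qed.

(** * q-Saalschutz and q-Vandermonde sums *)

Definition saal_term q A n b N s :=
  cpow q (s * (s + b)) * qfac q (A + (n + b) + N - s)
  * (rqfac q A s * rqfac q n s * rqfac q N s * / qfac q s * / qfac q (b + s)).

(* Wilf-Zeilberger certificate for the first-order recurrence in N satisfied by the sum over s. *)
Definition saal_cert q A n b N s :=
  - (cpow q (S N - s + s * (s + b)) * qfac q (A + (n + b) + S N - s)
     * (rqfac q A s * rqfac q n s * rqfac q (S N) s
        * ((1 - cpow q s) * / qfac q s) * ((1 - cpow q (b + s)) * / qfac q (b + s)))).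

Lemma saal_wz q A n b N s :
  (Cmod q < 1)%R ->
  (1 - cpow q (S N)) * (1 - cpow q (S N + b)) * saal_term q A n b (S N) s
  - (1 - cpow q (A + b + S N)) * (1 - cpow q (n + b + S N)) * saal_term q A n b N s
  = saal_cert q A n b N (S s) - saal_cert q A n b N s.
Proof.
  intros Hq. unfold saal_term, saal_cert.
  rewrite inv_qfac_S by easy.
  replace (b + S s)%nat with (S (b + s)) by lia. rewrite inv_qfac_S by easy.
  rewrite !(rqfac_step q _ s) by easy. rewrite (rqfac_pred q N s) by easy.
  destruct (le_lt_dec s A) as [HA|HA];
    [|rewrite (rqfac_out q A s) by lia; ring].
  destruct (le_lt_dec s n) as [Hn|Hn];
    [|rewrite (rqfac_out q n s) by lia; ring].
  destruct (le_lt_dec s (S N)) as [HN|HN];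
    [|rewrite (rqfac_out q (S N) s) by lia; ring].
  generalize (rqfac q A s) (rqfac q n s) (rqfac q (S N) s)
    (/ qfac q s) (/ qfac q (b + s)). intros r1 r2 r3 r4 r5.
  replace (A + (n + b) + S N - S s)%nat with (A + (n + b) + N - s)%nat by lia.
  replace (A + (n + b) + S N - s)%nat with (S (A + (n + b) + N - s)) by lia.
  rewrite qfac_S.
  generalize (qfac q (A + (n + b) + N - s)). intros Z.
  replace (S (A + (n + b) + N - s)) with (A + (n + b) + S N - s)%nat by lia.
  (* Writing A, n and N+1 as s plus an offset turns truncated subtraction into addition; what is
     left is a polynomial identity in powers of q. *)
  remember (S N - s)%nat as z eqn:Ez. remember (A - s)%nat as x eqn:Ex.
  remember (n - s)%nat as y eqn:Ey.
  replace (S N) with (z + s)%nat in * by lia.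
  replace A with (x + s)%nat in * by lia. replace n with (y + s)%nat in * by lia.
  replace (x + s + (y + s + b) + (z + s) - s)%nat with (x + s + y + s + b + z)%nat by lia.
  (* At s = N+1 the exponent N+1-(s+1) truncates to 0 instead of -1; this is harmless because the
     accompanying factor 1 - q^(N+1-s) is 0. *)
  destruct z as [|z].
  - replace (S s * (S s + b))%nat with (s * (s + b) + s + s + 1 + b)%nat by ring.
    replace (0 + s - S s)%nat with O by lia.
    rewrite !cpow_add. simpl. ring.
  - replace (S z + s - S s)%nat with z by lia.
    replace (S s * (S s + b))%nat with (s * (s + b) + s + s + 1 + b)%nat by ring.
    replace (S z) with (z + 1)%nat by lia.
    rewrite !cpow_add. simpl. ring.
Qed.

(** Induction on N. Summed over s < K, the relation [saal_wz] telescopes to 0: the certificate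
    vanishes at s = 0 through its factor 1 - q^s and at s = K through 1/(q)_(n-K) with n < K. The
    closed form obeys the same recurrence, and at N = 0 only s = 0 survives. *)
Lemma q_saalschutz q A n b N K :
  (Cmod q < 1)%R -> (n < K)%nat ->
  sumC (saal_term q A n b N) K
  = qfac q (A + (n + b)) * qfac q (A + b + N) * qfac q (n + b + N)
    / (qfac q A * qfac q (n + b) * qfac q N * qfac q (A + b)
       * qfac q n * qfac q (b + N)).
Proof.
  intros Hq HK. induction N as [|N IH].
  - rewrite (sumC_first (saal_term q A n b 0)); [|lia|].
    2:{ intros i Hi. unfold saal_term. rewrite (rqfac_out q 0) by lia. ring. }
    unfold saal_term. rewrite !rqfac_0, Nat.mul_0_l, !Nat.add_0_r, Nat.sub_0_r.
    change (qfac q 0) with (RtoC 1). change (cpow q 0) with (RtoC 1). field.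
    repeat split; now apply qfac_neq.
  - assert (Hw : sumC (fun s =>
        (1 - cpow q (S N)) * (1 - cpow q (S N + b)) * saal_term q A n b (S N) s
        - (1 - cpow q (A + b + S N)) * (1 - cpow q (n + b + S N))
          * saal_term q A n b N s) K = 0).
    { rewrite (sumC_ext _ (fun s => saal_cert q A n b N (S s) - saal_cert q A n b N s))
        by (intros; now apply saal_wz).
      rewrite (sumC_telescope (saal_cert q A n b N)). unfold saal_cert.
      rewrite (rqfac_out q n K) by lia.
      simpl. ring. }
    rewrite sumC_minus, !sumC_scal, IH in Hw.
    replace (A + b + S N)%nat with (S (A + b + N)) in * by lia.
    replace (n + b + S N)%nat with (S (n + b + N)) in * by lia.
    replace (b + S N)%nat with (S (b + N)) in * by lia.
    replace (S N + b)%nat with (S (b + N)) in * by lia.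
    pose proof (one_minus_cpow_neq q N Hq) as H1.
    pose proof (one_minus_cpow_neq q (b + N) Hq) as H2.
    apply (Cmult_reg_l ((1 - cpow q (S N)) * (1 - cpow q (S (b + N)))));
      [now apply Cmult_neq_0|].
    apply Ceq_minus in Hw. rewrite Hw, !qfac_S. field.
    repeat split; auto using qfac_neq.
Qed.

(* The limit N -> infinity of [saal_term], up to a constant; the certificate
   has the same shape, now for a recurrence in A. *)
Definition vdm_term q A n b s :=
  cpow q (s * (s + b))
  * (rqfac q n s * rqfac q A s * / qfac q s * / qfac q (b + s)).

Definition vdm_cert q A n b s :=
  - (cpow q (S A - s + s * (s + b))
     * (rqfac q n s * rqfac q (S A) s
        * ((1 - cpow q s) * / qfac q s) * ((1 - cpow q (b + s)) * / qfac q (b + s)))).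

Lemma vdm_wz q A n b s :
  (Cmod q < 1)%R ->
  (1 - cpow q (S A)) * (1 - cpow q (S A + b)) * vdm_term q (S A) n b s
  - (1 - cpow q (S A + n + b)) * vdm_term q A n b s
  = vdm_cert q A n b (S s) - vdm_cert q A n b s.
Proof.
  intros Hq. unfold vdm_term, vdm_cert.
  rewrite inv_qfac_S by easy.
  replace (b + S s)%nat with (S (b + s)) by lia. rewrite inv_qfac_S by easy.
  rewrite !(rqfac_step q _ s) by easy. rewrite (rqfac_pred q A s) by easy.
  destruct (le_lt_dec s n) as [Hn|Hn];
    [|rewrite (rqfac_out q n s) by lia; ring].
  destruct (le_lt_dec s (S A)) as [HN|HN];
    [|rewrite (rqfac_out q (S A) s) by lia; ring].
  generalize (rqfac q n s) (rqfac q (S A) s) (/ qfac q s) (/ qfac q (b + s)).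
  intros r2 r3 r4 r5.
  remember (S A - s)%nat as z eqn:Ez. remember (n - s)%nat as y eqn:Ey.
  replace (S A) with (z + s)%nat in * by lia. replace n with (y + s)%nat in * by lia.
  replace (S s * (S s + b))%nat with (s * (s + b) + s + s + 1 + b)%nat by ring.
  destruct z as [|z].
  - replace (0 + s - S s)%nat with O by lia. rewrite !cpow_add. simpl. ring.
  - replace (S z + s - S s)%nat with z by lia.
    replace (S z) with (z + 1)%nat by lia.
    rewrite !cpow_add. simpl. ring.
Qed.

(** Multiplied by (q)_A (q)_(n+b), this is the q-Chu-Vandermonde sum of q^(s(s+b)) [A; s]
    [n+b; n-s], with value [A+n+b; n]. *)
Lemma q_vandermonde q A n b K :
  (Cmod q < 1)%R -> (n < K)%nat ->
  sumC (vdm_term q A n b) K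
  = qfac q (A + n + b)
    / (qfac q n * qfac q (A + b) * qfac q A * qfac q (n + b)).
Proof.
  intros Hq HK. induction A as [|A IH].
  - rewrite (sumC_first (vdm_term q 0 n b)); [|lia|].
    2:{ intros i Hi. unfold vdm_term. rewrite (rqfac_out q 0) by lia. ring. }
    unfold vdm_term. rewrite !rqfac_0, Nat.mul_0_l, !Nat.add_0_r, !Nat.add_0_l.
    change (qfac q 0) with (RtoC 1). change (cpow q 0) with (RtoC 1). field.
    repeat split; now apply qfac_neq.
  - assert (Hw : sumC (fun s =>
        (1 - cpow q (S A)) * (1 - cpow q (S A + b)) * vdm_term q (S A) n b s
        - (1 - cpow q (S A + n + b)) * vdm_term q A n b s) K = 0).
    { rewrite (sumC_ext _ (fun s => vdm_cert q A n b (S s) - vdm_cert q A n b s))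
        by (intros; now apply vdm_wz).
      rewrite (sumC_telescope (vdm_cert q A n b)). unfold vdm_cert.
      rewrite (rqfac_out q n K) by lia.
      simpl. ring. }
    rewrite sumC_minus, !sumC_scal, IH in Hw.
    change (S A + n + b)%nat with (S (A + n + b)) in *.
    change (S A + b)%nat with (S (A + b)) in *.
    pose proof (one_minus_cpow_neq q A Hq) as H1.
    pose proof (one_minus_cpow_neq q (A + b) Hq) as H2.
    apply (Cmult_reg_l ((1 - cpow q (S A)) * (1 - cpow q (S (A + b)))));
      [now apply Cmult_neq_0|].
    apply Ceq_minus in Hw. rewrite Hw, !qfac_S. field.
    repeat split; auto using qfac_neq.
Qed.

(* The further limit n -> infinity. *)
Definition vdm_inf_term q A b s :=
  cpow q (s * (s + b)) * (rqfac q A s * / qfac q s * / qfac q (b + s)).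

Definition vdm_inf_cert q A b s :=
  - (cpow q (S A - s + s * (s + b))
     * (rqfac q (S A) s
        * ((1 - cpow q s) * / qfac q s) * ((1 - cpow q (b + s)) * / qfac q (b + s)))).

Lemma vdm_inf_wz q A b s :
  (Cmod q < 1)%R ->
  (1 - cpow q (S A)) * (1 - cpow q (S A + b)) * vdm_inf_term q (S A) b s
  - vdm_inf_term q A b s
  = vdm_inf_cert q A b (S s) - vdm_inf_cert q A b s.
Proof.
  intros Hq. unfold vdm_inf_term, vdm_inf_cert.
  rewrite inv_qfac_S by easy.
  replace (b + S s)%nat with (S (b + s)) by lia. rewrite inv_qfac_S by easy.
  rewrite !(rqfac_step q _ s) by easy. rewrite (rqfac_pred q A s) by easy.
  destruct (le_lt_dec s (S A)) as [HN|HN];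
    [|rewrite (rqfac_out q (S A) s) by lia; ring].
  generalize (rqfac q (S A) s) (/ qfac q s) (/ qfac q (b + s)).
  intros r3 r4 r5.
  remember (S A - s)%nat as z eqn:Ez.
  replace (S A) with (z + s)%nat in * by lia.
  replace (S s * (S s + b))%nat with (s * (s + b) + s + s + 1 + b)%nat by ring.
  destruct z as [|z].
  - replace (0 + s - S s)%nat with O by lia. rewrite !cpow_add. simpl. ring.
  - replace (S z + s - S s)%nat with z by lia.
    replace (S z) with (z + 1)%nat by lia.
    rewrite !cpow_add. simpl. ring.
Qed.

Lemma q_vandermonde_inf q A b K :
  (Cmod q < 1)%R -> (A < K)%nat ->
  sumC (vdm_inf_term q A b) K = / (qfac q A * qfac q (A + b)).
Proof.
  intros Hq. revert K. induction A as [|A IH]; intros K HK.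
  - rewrite (sumC_first (vdm_inf_term q 0 b)); [|lia|].
    2:{ intros i Hi. unfold vdm_inf_term. rewrite (rqfac_out q 0) by lia. ring. }
    unfold vdm_inf_term. rewrite !rqfac_0, Nat.mul_0_l, !Nat.add_0_r, !Nat.add_0_l.
    change (qfac q 0) with (RtoC 1). change (cpow q 0) with (RtoC 1). field.
    repeat split; now apply qfac_neq.
  - assert (Hw : sumC (fun s =>
        (1 - cpow q (S A)) * (1 - cpow q (S A + b)) * vdm_inf_term q (S A) b s
        - vdm_inf_term q A b s) K = 0).
    { rewrite (sumC_ext _ (fun s => vdm_inf_cert q A b (S s) - vdm_inf_cert q A b s))
        by (intros; now apply vdm_inf_wz).
      rewrite (sumC_telescope (vdm_inf_cert q A b)). unfold vdm_inf_cert.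
      rewrite (rqfac_out q (S A) K) by lia.
      simpl. ring. }
    rewrite sumC_minus, !sumC_scal, IH in Hw by lia.
    change (S A + b)%nat with (S (A + b)) in *.
    pose proof (one_minus_cpow_neq q A Hq) as H1.
    pose proof (one_minus_cpow_neq q (A + b) Hq) as H2.
    apply (Cmult_reg_l ((1 - cpow q (S A)) * (1 - cpow q (S (A + b)))));
      [now apply Cmult_neq_0|].
    apply Ceq_minus in Hw. rewrite Hw, !qfac_S. field.
    repeat split; auto using qfac_neq.
Qed.

(** * Finite Jacobi triple product *)

(* j(j-1)/2 *)
Fixpoint tri (j : nat) : nat := match j with O => O | S j => (tri j + j)%nat end.

Lemma tri_double j : (2 * tri j + j = j * j)%nat.
Proof. induction j as [|j IH]; simpl tri; lia. Qed.

Definition theta_sym (q x y : C) (j : nat) : C :=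
  cpow (-(1)) j * cpow q (tri j) * (cpow x j + cpow y j).

(* The two-sided theta series folded onto j >= 0: the terms j and -j are added for j > 0. *)
Definition theta_coef (q x y : C) (j : nat) : C :=
  match j with O => 1 | S _ => theta_sym q x y j end.

(** The q-binomial [2n; n-j], the coefficient in the finite triple product, extended by 0 to j >
    n. *)
Definition central_qbin (q : C) (n j : nat) : C :=
  qfac q (2 * n) * rqfac q n j * / qfac q (n + j).

Lemma central_qbin_out q n j : (n < j)%nat -> central_qbin q n j = 0.
Proof. intros H. unfold central_qbin. rewrite rqfac_out by easy. ring. Qed.

Lemma qfac_double_S q n :
  qfac q (2 * S n)
  = qfac q (2 * n) * (1 - cpow q (2 * n + 1)) * (1 - cpow q (2 * n + 2)).
Proof.
  replace (2 * S n)%nat with (S (S (2 * n))) by lia. rewrite !qfac_S.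
  now replace (2 * n + 1)%nat with (S (2 * n)) by lia;
    replace (2 * n + 2)%nat with (S (S (2 * n))) by lia.
Qed.

(** Amounts to applying each of the two q-Pascal rules once to [2n+2; n-j]. *)
Lemma central_qbin_rec q n j :
  (Cmod q < 1)%R ->
  central_qbin q (S n) (S j)
  = (1 + cpow q (2 * n + 1)) * central_qbin q n (S j)
    + cpow q (n - j) * central_qbin q n j
    + cpow q (n + j + 2) * central_qbin q n (S (S j)).
Proof.
  intros Hq. unfold central_qbin. rewrite qfac_double_S.
  rewrite !(rqfac_step q n) by easy.
  replace (rqfac q (S n) (S j)) with (rqfac q n j) by (apply rqfac_eq; lia).
  replace (n + S (S j))%nat with (S (S (n + j))) by lia.
  replace (S n + S j)%nat with (S (S (n + j))) by lia.
  replace (n + S j)%nat with (S (n + j)) by lia.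
  rewrite <- (inv_qfac_S q (n + j)), <- (inv_qfac_S q (S (n + j))) by easy.
  destruct (le_lt_dec j n) as [H|H]; [|rewrite rqfac_out by lia; ring].
  generalize (qfac q (2 * n)) (rqfac q n j) (/ qfac q (S (S (n + j)))).
  intros X Y Z. remember (n - j)%nat as z eqn:Ez.
  replace n with (z + j)%nat by lia. destruct z as [|z].
  - replace (0 + j - S j)%nat with O by lia.
    replace (S (S (0 + j + j))) with (j + j + 2)%nat by lia.
    replace (S (0 + j + j)) with (j + j + 1)%nat by lia.
    replace (2 * (0 + j) + 1)%nat with (j + j + 1)%nat by lia.
    replace (2 * (0 + j) + 2)%nat with (j + j + 2)%nat by lia.
    rewrite !cpow_add. simpl. ring.
  - replace (S z + j - S j)%nat with z by lia.
    replace (S z) with (z + 1)%nat by lia.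
    replace (S (S (z + 1 + j + j))) with (z + j + j + 3)%nat by lia.
    replace (S (z + 1 + j + j)) with (z + j + j + 2)%nat by lia.
    replace (2 * (z + 1 + j) + 1)%nat with (z + j + z + j + 3)%nat by lia.
    replace (2 * (z + 1 + j) + 2)%nat with (z + j + z + j + 4)%nat by lia.
    rewrite !cpow_add. simpl. ring.
Qed.

(** The same recurrence at j = -1: the symmetry [2n; n+1] = [2n; n-1] merges the outer terms, whence
    the factor 2. *)
Lemma central_qbin_rec0 q n :
  (Cmod q < 1)%R ->
  central_qbin q (S n) 0
  = (1 + cpow q (2 * n + 1)) * central_qbin q n 0
    + 2 * cpow q (n + 1) * central_qbin q n 1.
Proof.
  intros Hq. unfold central_qbin. rewrite qfac_double_S.
  rewrite (rqfac_step q n 0) by easy. rewrite (rqfac_pred q n 0) by easy.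
  rewrite !Nat.add_0_r, !Nat.sub_0_r. change (S n - 0)%nat with (S n).
  replace (n + 1)%nat with (S n) by lia.
  rewrite <- (inv_qfac_S q n) by easy.
  generalize (qfac q (2 * n)) (rqfac q (S n) 0) (/ qfac q (S n)).
  intros X Y Z.
  replace (S n) with (n + 1)%nat by lia.
  replace (2 * n + 1)%nat with (n + n + 1)%nat by lia.
  replace (2 * n + 2)%nat with (n + n + 2)%nat by lia.
  rewrite !cpow_add. simpl. ring.
Qed.

(** From (x+y)(x^(j+1) + y^(j+1)) = (x^(j+2) + y^(j+2)) + xy (x^j + y^j) with xy = q; the sign and
    the factors q^(j(j-1)/2) account for the rest. *)
Lemma theta_sym_rec q x y n j :
  x * y = q -> (j < n)%nat ->
  (x + y) * cpow q n * theta_sym q x y (S j)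
  = - (cpow q (n - S j) * theta_sym q x y (S (S j))
       + cpow q (n + j + 1) * theta_sym q x y j).
Proof.
  intros E H. unfold theta_sym.
  replace (tri (S (S j))) with (tri j + j + j + 1)%nat by (simpl; lia).
  replace (tri (S j)) with (tri j + j)%nat by reflexivity.
  remember (n - S j)%nat as z eqn:Ez.
  replace n with (z + j + 1)%nat by lia. rewrite !cpow_add. simpl.
  generalize (cpow (-(1)) j) (cpow q (tri j)) (cpow q j) (cpow q z) (cpow x j) (cpow y j).
  intros. subst q. ring.
Qed.

(* With W(j) the central q-binomial, the three-term recurrence of W in j and that of [theta_sym] make the
   coefficient-wise recurrence in n telescope. *)
Definition theta_cert (q x y : C) (n j : nat) : C :=
  match j with
  | O => 0
  | S j => cpow q (n + j + 1) * theta_sym q x y j * central_qbin q n (S j)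
           - cpow q (n - j) * theta_sym q x y (S j) * central_qbin q n j
  end.

Lemma theta_wz q x y n j :
  (Cmod q < 1)%R -> x * y = q ->
  theta_coef q x y j * central_qbin q (S n) j
  - (1 + cpow q (2 * n + 1) - (x + y) * cpow q n)
    * (theta_coef q x y j * central_qbin q n j)
  = theta_cert q x y n (S j) - theta_cert q x y n j.
Proof.
  intros Hq E. destruct j as [|j]; simpl theta_coef; simpl theta_cert.
  - rewrite central_qbin_rec0 by easy. unfold theta_sym.
    rewrite !Nat.add_0_r, Nat.sub_0_r. simpl. ring.
  - rewrite central_qbin_rec by easy.
    replace (n + S j + 1)%nat with (n + j + 2)%nat by lia.
    destruct (le_lt_dec n j) as [H|H].
    + rewrite (central_qbin_out q n (S j)) by lia. ring.
    + transitivity (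
        (x + y) * cpow q n * theta_sym q x y (S j) * central_qbin q n (S j)
        + theta_sym q x y (S j) * (cpow q (n - j) * central_qbin q n j
          + cpow q (n + j + 2) * central_qbin q n (S (S j)))); [ring|].
      rewrite theta_sym_rec by easy. ring.
Qed.

(** Induction on n: since xy = q, the new factor (1 - x q^n)(1 - y q^n) is 1 + q^(2n+1) - (x+y) q^n,
    and [theta_wz] gives the sum the same factor. Using a pair x, y with xy = q in place of x and
    q/x avoids division, and admits y = 1. *)
Lemma finite_jacobi_triple q x y n K :
  (Cmod q < 1)%R -> x * y = q -> (n < K)%nat ->
  qpoch x q n * qpoch y q n
  = sumC (fun j => theta_coef q x y j * central_qbin q n j) K.
Proof.
  intros Hq E. revert K. induction n as [|n IH]; intros K HK.
  - rewrite (sumC_first (fun j => _ * _)); [|lia|].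
    2:{ intros j Hj. rewrite central_qbin_out by lia. ring. }
    unfold central_qbin. rewrite rqfac_0. simpl. change (qfac q 0) with (RtoC 1). field.
  - transitivity ((1 + cpow q (2 * n + 1) - (x + y) * cpow q n)
                  * (qpoch x q n * qpoch y q n)).
    { simpl. replace (n + (n + 0) + 1)%nat with (n + n + 1)%nat by lia.
      rewrite !cpow_add. simpl. 
      generalize (cpow q n) (qpoch x q n) (qpoch y q n). intros. rewrite <- E. ring. }
    rewrite (IH K) by lia. rewrite <- sumC_scal. symmetry. apply Ceq_minus.
    rewrite <- sumC_minus.
    rewrite (sumC_ext _ (fun j => theta_cert q x y n (S j) - theta_cert q x y n j))
      by (intros; now apply theta_wz).
    rewrite (sumC_telescope (theta_cert q x y n)). destruct K as [|K]; [lia|].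
    simpl. rewrite !central_qbin_out by lia. ring.
Qed.

(** * Bailey sums and the Burge transform *)

Lemma sumC_scal_r c (f : nat -> C) n : sumC (fun i => f i * c) n = sumC f n * c.
Proof. induction n as [|n IH]; simpl; [ring|]. rewrite IH. ring. Qed.

(** The matrix 1/((q)_(n-r) (q)_(n+r)) that defines Bailey pairs relative to 1. *)
Definition bailey_kernel (q : C) (n r : nat) : C := rqfac q n r * / qfac q (n + r).

Lemma bailey_kernel_out q n r : (n < r)%nat -> bailey_kernel q n r = 0.
Proof. intros H. unfold bailey_kernel. rewrite rqfac_out by easy. ring. Qed.

Lemma square_shift q r s :
  cpow q ((r + s) * (r + s)) = cpow q (r * r) * cpow q (s * (s + 2 * r)).
Proof. rewrite <- cpow_add. f_equal. ring. Qed.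

(** The substitution t = r+s gives [q_vandermonde] with parameters p-r, n-r and 2r; t^2 = r^2 +
    s(s+2r) releases the factor q^(r^2). If r exceeds n or p, both sides are 0. *)
Lemma bailey_sum q n p r K :
  (Cmod q < 1)%R -> (n < K)%nat ->
  sumC (fun t => cpow q (t * t) * (rqfac q n t * rqfac q p t * bailey_kernel q t r)) K
  = cpow q (r * r) * qfac q (n + p) * (bailey_kernel q n r * bailey_kernel q p r).
Proof.
  intros Hq HK.
  destruct (le_lt_dec r n) as [Hn|Hn];
    [|rewrite (bailey_kernel_out q n) by lia; rewrite sumC_zero; [ring|];
      intros t Ht; destruct (le_lt_dec r t);
        [rewrite (rqfac_out q n t) by lia|rewrite bailey_kernel_out by lia]; ring].
  destruct (le_lt_dec r p) as [Hp|Hp];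
    [|rewrite (bailey_kernel_out q p) by lia; rewrite sumC_zero; [ring|];
      intros t Ht; destruct (le_lt_dec r t);
        [rewrite (rqfac_out q p t) by lia|rewrite bailey_kernel_out by lia]; ring].
  rewrite (sumC_shift _ r) by (try lia; intros; rewrite bailey_kernel_out by lia; ring).
  rewrite (sumC_ext _ (fun s => cpow q (r * r) * vdm_term q (p - r) (n - r) (2 * r) s)).
  2:{ intros s _. unfold vdm_term, bailey_kernel. rewrite square_shift.
      rewrite (rqfac_eq q n (n - r) (r + s) s), (rqfac_eq q p (p - r) (r + s) s),
        (rqfac_eq q (r + s) s r 0), rqfac_0 by lia.
      replace (r + s + r)%nat with (2 * r + s)%nat by lia. ring. }
  rewrite sumC_scal, q_vandermonde by (auto; lia). unfold bailey_kernel.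
  rewrite !rqfac_in by lia.
  replace (p - r + (n - r) + 2 * r)%nat with (n + p)%nat by lia.
  replace (p - r + 2 * r)%nat with (p + r)%nat by lia.
  replace (n - r + 2 * r)%nat with (n + r)%nat by lia.
  field. repeat split; now apply qfac_neq.
Qed.

(** The limit p -> infinity of [bailey_sum], by the same shift. *)
Lemma bailey_sum_inf q n r K :
  (Cmod q < 1)%R -> (n < K)%nat ->
  sumC (fun t => cpow q (t * t) * (rqfac q n t * bailey_kernel q t r)) K
  = cpow q (r * r) * bailey_kernel q n r.
Proof.
  intros Hq HK.
  destruct (le_lt_dec r n) as [Hn|Hn];
    [|rewrite (bailey_kernel_out q n) by lia; rewrite sumC_zero; [ring|];
      intros t Ht; destruct (le_lt_dec r t);
        [rewrite (rqfac_out q n t) by lia|rewrite bailey_kernel_out by lia]; ring].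
  rewrite (sumC_shift _ r) by (try lia; intros; rewrite bailey_kernel_out by lia; ring).
  rewrite (sumC_ext _ (fun s => cpow q (r * r) * vdm_inf_term q (n - r) (2 * r) s)).
  2:{ intros s _. unfold vdm_inf_term, bailey_kernel. rewrite square_shift.
      rewrite (rqfac_eq q n (n - r) (r + s) s), (rqfac_eq q (r + s) s r 0), rqfac_0 by lia.
      replace (r + s + r)%nat with (2 * r + s)%nat by lia. ring. }
  rewrite sumC_scal, q_vandermonde_inf by (auto; lia). unfold bailey_kernel.
  rewrite !rqfac_in by lia.
  replace (n - r + 2 * r)%nat with (n + r)%nat by lia.
  field. repeat split; now apply qfac_neq.
Qed.

Lemma qpoch_1 q n : qpoch 1 q (S n) = 0.
Proof. induction n as [|n IH]; [simpl; ring|]. cbn [qpoch] in *. rewrite IH. ring. Qed.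

(* The triple product at x = q, y = 1, where the factor (1;q)_t vanishes unless t = 0. *)
Lemma unit_bailey_pair q t K :
  (Cmod q < 1)%R -> (t < K)%nat ->
  sumC (fun j => theta_coef q q 1 j * bailey_kernel q t j) K
  = match t with O => 1 | S _ => 0 end.
Proof.
  intros Hq HK. apply (Cmult_reg_l (qfac q (2 * t))); [now apply qfac_neq|].
  rewrite <- sumC_scal.
  rewrite (sumC_ext _ (fun j => theta_coef q q 1 j * central_qbin q t j)).
  2:{ intros j _. unfold central_qbin, bailey_kernel. ring. }
  rewrite <- finite_jacobi_triple by (auto; ring).
  destruct t as [|t]; [simpl; unfold qfac; simpl; ring|]. rewrite qpoch_1. ring.
Qed.

(* B(L,M,a,b) = [L+M+a-b; L+a] [L+M-a+b; L-a] at L = x-y, M = y. *)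
Definition burge (q : C) (x y a b : nat) : C :=
  qfac q (x + a - b) * qfac q (x + b - a)
  * (rqfac q x (y + a) * / qfac q (x - y + a)) * bailey_kernel q y b.

Lemma burge_out q x y a b : (x < y + a \/ y < b)%nat -> burge q x y a b = 0.
Proof.
  intros [H|H]; unfold burge;
    [rewrite rqfac_out by easy|rewrite bailey_kernel_out by easy]; ring.
Qed.

(* q-Dixon: [bailey_sum] turns the alternating sum over j into one over t that [unit_bailey_pair]
   collapses to t = 0. *)
Lemma qbin_base q x y J :
  (Cmod q < 1)%R -> (y < J)%nat ->
  qbin q (Z.of_nat x) y
  = sumC (fun j => theta_coef q q 1 j * (cpow q (j * j) * burge q x y j j)) J.
Proof.
  intros Hq HJ. unfold qbin. destruct (Z.leb_spec (Z.of_nat y) (Z.of_nat x)) as [H|H].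
  2:{ rewrite sumC_zero; [easy|]. intros. rewrite burge_out by lia. ring. }
  rewrite Nat2Z.id. set (L := (x - y)%nat).
  rewrite (sumC_ext _ (fun j => sumC (fun t => qfac q x
      * (cpow q (t * t) * (rqfac q y t * rqfac q L t))
      * (theta_coef q q 1 j * bailey_kernel q t j)) J)).
  2:{ intros j _. rewrite (sumC_ext _ (fun t => (qfac q x * theta_coef q q 1 j)
          * (cpow q (t * t) * (rqfac q y t * rqfac q L t * bailey_kernel q t j))))
        by (intros; ring).
      rewrite sumC_scal, bailey_sum by easy. unfold burge.
      replace (x + j - j)%nat with x by lia. replace (y + L)%nat with x by (unfold L; lia).
      rewrite (rqfac_eq q x L (y + j) j) by (unfold L; lia).
      unfold bailey_kernel. fold L. ring. }
  rewrite sumC_swap.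
  rewrite (sumC_ext _ (fun t => qfac q x * (cpow q (t * t) * (rqfac q y t * rqfac q L t))
      * match t with O => 1 | S _ => 0 end)).
  2:{ intros t Ht. rewrite sumC_scal. f_equal. now apply unit_bailey_pair. }
  rewrite (sumC_first (fun t => _ * _)); [|lia|intros [|i] Hi; [lia|ring]].
  rewrite !rqfac_0. simpl. field. split; now apply qfac_neq.
Qed.

(** With z = b+s, the smallest useful z being b, the weighted [burge] factor is a q-Vandermonde
    term. This serves both the Burge transform and its limit. *)
Lemma burge_shift q y a b s :
  (a + b <= y)%nat ->
  cpow q ((b + s) * (b + s)) * burge q y (b + s) a b
  = cpow q (b * b) * (qfac q (y + a - b) * qfac q (y + b - a))
    * vdm_term q (y + a - b) (y - a - b) (2 * b) s.
Proof.
  intros H. unfold burge, vdm_term, bailey_kernel. rewrite square_shift.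
  rewrite (rqfac_eq q y (y - a - b) (b + s + a) s), (rqfac_eq q (b + s) s b 0), rqfac_0
    by lia.
  replace (b + s + b)%nat with (2 * b + s)%nat by lia.
  destruct (le_lt_dec s (y - a - b)) as [Hs|Hs].
  - rewrite (rqfac_in q (y + a - b) s) by lia.
    replace (y - (b + s) + a)%nat with (y + a - b - s)%nat by lia. ring.
  - rewrite (rqfac_out q (y - a - b) s) by lia. ring.
Qed.

(** The two factors depending on s are exactly those that [saal_term] has beyond [vdm_term], with N
    = x-y-b. *)
Lemma qbin_shift q x y b s :
  (Cmod q < 1)%R -> (y + b <= x)%nat ->
  qbin q (Z.of_nat x + Z.of_nat y - Z.of_nat (b + s)) (2 * y)
  = / qfac q (2 * y) * (qfac q (x + y - b - s) * rqfac q (x - y - b) s).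
Proof.
  intros Hq H. unfold qbin.
  destruct (Z.leb_spec (Z.of_nat (2 * y)) (Z.of_nat x + Z.of_nat y - Z.of_nat (b + s))).
  - replace (Z.to_nat (Z.of_nat x + Z.of_nat y - Z.of_nat (b + s)))
      with (x + y - b - s)%nat by lia.
    rewrite rqfac_in by lia.
    replace (x + y - b - s - 2 * y)%nat with (x - y - b - s)%nat by lia.
    field. split; now apply qfac_neq.
  - rewrite rqfac_out by lia. ring.
Qed.

(** With z = b+s this is [q_saalschutz] at A = y+a-b, n = y-a-b, shift 2b and N = x-y-b. The range z
    < N is complete because the summand vanishes for z > y. The swap of L and M is built into the
    encoding: y is L+M in [burge q y z] and M in [burge q x y], so (b, a+b) appears directly. *)
Lemma burge_transform q x y a b N :
  (Cmod q < 1)%R -> (a <= b)%nat -> (y < N)%nat ->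
  sumC (fun z => qbin q (Z.of_nat x + Z.of_nat y - Z.of_nat z) (2 * y)
                 * (cpow q (z * z) * burge q y z a b)) N
  = cpow q (b * b) * burge q x y b (a + b).
Proof.
  intros Hq Hab HN.
  destruct (le_lt_dec (a + b) y) as [Hy|Hy].
  2:{ rewrite (burge_out q x y) by lia. rewrite sumC_zero; [ring|].
      intros z _. rewrite burge_out by lia. ring. }
  destruct (le_lt_dec (y + b) x) as [Hx|Hx].
  2:{ rewrite (burge_out q x y) by lia. rewrite sumC_zero; [ring|].
      intros z _. destruct (le_lt_dec b z); [|rewrite burge_out by lia; ring].
      unfold qbin. rewrite (proj2 (Z.leb_gt _ _)) by lia. ring. }
  rewrite (sumC_shift _ b) by (try lia; intros; rewrite burge_out by lia; ring).
  set (n := (y - a - b)%nat). set (M := (x - y - b)%nat).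
  rewrite (sumC_ext _ (fun s => / qfac q (2 * y) * cpow q (b * b)
      * (qfac q (y + a - b) * qfac q (y + b - a))
      * saal_term q (y + a - b) n (2 * b) M s)).
  2:{ intros s _. rewrite burge_shift, qbin_shift by easy.
      unfold vdm_term, saal_term. fold n M.
      replace (y + a - b + (n + 2 * b) + M - s)%nat with (x + y - b - s)%nat
        by (unfold n, M; lia). ring. }
  rewrite sumC_scal, q_saalschutz by (auto; unfold n; lia).
  unfold burge, bailey_kernel. rewrite !rqfac_in by lia.
  replace (y + b - a)%nat with (n + 2 * b)%nat by (unfold n; lia).
  replace (y + a - b)%nat with (n + 2 * a)%nat by (unfold n; lia).
  replace (2 * y)%nat with (n + 2 * a + (n + 2 * b))%nat by (unfold n; lia).
  replace (x + b - (a + b))%nat with (n + 2 * b + M)%nat by (unfold n, M; lia).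
  replace (x + (a + b) - b)%nat with (n + 2 * a + 2 * b + M)%nat by (unfold n, M; lia).
  replace (x - (y + b))%nat with M by (unfold M; lia).
  replace (x - y + b)%nat with (2 * b + M)%nat by (unfold M; lia).
  replace (y - (a + b))%nat with n by (unfold n; lia).
  replace (y + (a + b))%nat with (n + 2 * a + 2 * b)%nat by (unfold n; lia).
  field. repeat split; now apply qfac_neq.
Qed.

(** The limit x -> infinity of [burge_transform], multiplied by (q)_(2y), since [x+y-z; 2y] tends to
    1/(q)_(2y). It sums out m_3, because m_2 carries 1/(q)_(2 m_2) in place of a q-binomial. *)
Lemma burge_transform_inf q y a b N :
  (Cmod q < 1)%R -> (a <= b)%nat -> (y < N)%nat ->
  sumC (fun z => cpow q (z * z) * burge q y z a b) N
  = cpow q (b * b) * qfac q (2 * y) * bailey_kernel q y (a + b).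
Proof.
  intros Hq Hab HN.
  destruct (le_lt_dec (a + b) y) as [Hy|Hy].
  2:{ rewrite bailey_kernel_out by lia. rewrite sumC_zero; [ring|].
      intros z _. rewrite burge_out by lia. ring. }
  rewrite (sumC_shift _ b) by (try lia; intros; rewrite burge_out by lia; ring).
  set (n := (y - a - b)%nat).
  rewrite (sumC_ext _ (fun s => cpow q (b * b)
      * (qfac q (y + a - b) * qfac q (y + b - a))
      * vdm_term q (y + a - b) n (2 * b) s)) by (intros; now apply burge_shift).
  rewrite sumC_scal, q_vandermonde by (auto; unfold n; lia).
  unfold bailey_kernel. rewrite rqfac_in by lia.
  replace (y + b - a)%nat with (n + 2 * b)%nat by (unfold n; lia).
  replace (y + a - b)%nat with (n + 2 * a)%nat by (unfold n; lia).
  replace (n + 2 * a + n + 2 * b)%nat with (2 * y)%nat by (unfold n; lia).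
  replace (y - (a + b))%nat with n by (unfold n; lia).
  replace (y + (a + b))%nat with (n + 2 * a + 2 * b)%nat by (unfold n; lia).
  field. repeat split; now apply qfac_neq.
Qed.

(** * Summing out the inner variables *)

(* The part of the summand depending on (m_(j-1), m_j) = (x, y) and the later variables l. *)
Fixpoint chain (q : C) (x y : nat) (l : list nat) : C :=
  match l with
  | nil => cpow q (y * y) * qbin q (Z.of_nat x) y
  | z :: l =>
      cpow q (y * y)
      * (qbin q (Z.of_nat x + Z.of_nat y - Z.of_nat z) (2 * y) * chain q y z l)
  end.

Lemma seq_S_shift i n : seq i (S n) = i :: map S (seq i n).
Proof. now rewrite seq_shift. Qed.

(** Translates the recursion into the indexed form of the summand: for (x, y) = (m_2, m_3), [u j] is
    m_(j+2). *)
Lemma chain_nth q x y l :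
  let u := fun j => nth j (x :: y :: l) O in
  chain q x y l
  = cpow q (fold_right Nat.add O (map (fun j => u j ^ 2)%nat (seq 1 (S (length l)))))
    * cprod (map (fun j => qbin q (Z.of_nat (u (j - 1)%nat) + Z.of_nat (u j)
                                   - Z.of_nat (u (S j))) (2 * u j))
               (seq 1 (length l)))
    * qbin q (Z.of_nat (u (length l))) (u (S (length l))).
Proof.
  revert x y. induction l as [|z l IH]; intros x y u.
  - subst u. unfold cprod. simpl. rewrite Nat.mul_1_r, Nat.add_0_r. ring.
  - cbn [chain length]. rewrite IH.
    set (v := fun j => nth j (y :: z :: l) O). cbv zeta.
    change (map (fun j => nth j (y :: z :: l) O ^ 2)%nat)
      with (map (fun j => u (S j) ^ 2)%nat).
    rewrite (seq_S_shift 1 (S (length l))). cbn [map fold_right].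
    rewrite (map_map S), cpow_add.
    set (P := map (fun j => qbin q (Z.of_nat (nth (j - 1) _ O) + _ - _) _) _).
    replace (map _ (seq 1 (S (length l))))
      with (qbin q (Z.of_nat x + Z.of_nat y - Z.of_nat z) (2 * y) :: P).
    2:{ rewrite seq_S_shift. cbn [map]. f_equal. rewrite map_map.
        apply map_ext_in. intros j Hj. apply in_seq in Hj. unfold u.
        replace (S j - 1)%nat with (S (j - 1)) by lia. reflexivity. }
    replace (u 1 ^ 2)%nat with (y * y)%nat by (unfold u; simpl; lia).
    unfold u, cprod. cbn [fold_right nth]. ring.
Qed.

Lemma lhs_term_chain q k a x y l :
  (Cmod q < 1)%R -> (k = 5 + length l)%nat ->
  lhs_term k q (a :: x :: y :: l)
  = cpow q ((a + x) * (a + x)) * cpow q (x * x)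
    * (/ qfac q a * / qfac q (2 * x)) * chain q x y l.
Proof.
  intros Hq ->. rewrite chain_nth. unfold lhs_term.
  replace (5 + length l - 2)%nat with (3 + length l)%nat by lia.
  replace (3 + length l - 1)%nat with (S (S (length l))) by lia.
  replace (3 + length l - 3)%nat with (length l) by lia.
  rewrite (seq_S_shift 2), <- !(seq_shift _ 2), <- !(seq_shift _ 1).
  cbn [map fold_right]. rewrite !map_map.
  replace (map _ (seq 1 (length l))) with
    (map (fun j => qbin q (Z.of_nat (nth (j - 1) (x :: y :: l) O)
        + Z.of_nat (nth j (x :: y :: l) O) - Z.of_nat (nth (S j) (x :: y :: l) O))
        (2 * nth j (x :: y :: l) O)) (seq 1 (length l))).
  2:{ apply map_ext_in. intros j Hj. apply in_seq in Hj.
      replace (S (S j) - 1 - 1)%nat with (S (j - 1)) by lia.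
      replace (S (S j) - 1)%nat with (S j) by lia.
      replace (S (S j) + 1 - 1)%nat with (S (S j)) by lia. reflexivity. }
  change (fun i => nth (S (S i) - 1) (a :: x :: y :: l) O ^ 2)%nat
    with (fun j => nth j (x :: y :: l) O ^ 2)%nat.
  rewrite !cpow_add.
  change (nth (S (S (length l)) - 1) (a :: x :: y :: l) O)
    with (nth (length l) (x :: y :: l) O).
  change (nth (S (S (length l))) (a :: x :: y :: l) O)
    with (nth (S (length l)) (x :: y :: l) O).
  change (nth (1 - 1) (a :: x :: y :: l) O) with a.
  change (nth (2 - 1) (a :: x :: y :: l) O) with x.
  rewrite !Nat.pow_2_r. field. split; now apply qfac_neq.
Qed.

Lemma csum_app l1 l2 : csum (l1 ++ l2) = csum l1 + csum l2.
Proof.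
  unfold csum. induction l1 as [|c l IH]; simpl; [ring|]. rewrite IH. ring.
Qed.

Lemma csum_seq f N : csum (map f (seq 0 N)) = sumC f N.
Proof.
  induction N as [|N IH]; [easy|].
  rewrite seq_S, map_app, csum_app, IH. unfold csum. simpl. ring.
Qed.

Lemma csum_scal {T : Type} c (f : T -> C) l :
  csum (map (fun i => c * f i) l) = c * csum (map f l).
Proof. unfold csum. induction l as [|i l IH]; simpl; [ring|]. rewrite IH. ring. Qed.

Lemma csum_tuples_S f d N :
  csum (map f (tuples (S d) N))
  = sumC (fun i => csum (map (fun l => f (i :: l)) (tuples d N))) N.
Proof.
  simpl. induction (tuples d N) as [|l L IH].
  - simpl. symmetry. now apply sumC_zero.
  - simpl. rewrite map_app, csum_app, IH, map_map, csum_seq, <- sumC_plus.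
    reflexivity.
Qed.

Lemma tuples_length d N l : In l (tuples d N) -> length l = d.
Proof.
  revert l. induction d as [|d IH]; intros l H; simpl in H.
  - now destruct H as [<-|[]].
  - apply in_flat_map in H. destruct H as (l' & H1 & H2).
    apply in_map_iff in H2. destruct H2 as (i & <- & _). simpl. f_equal. now apply IH.
Qed.

Lemma fib_SS n : fib (S (S n)) = (fib (S n) + fib n)%nat.
Proof. reflexivity. Qed.

Lemma fib_le_S n : (fib (S n) <= fib (S (S n)))%nat.
Proof. rewrite fib_SS. lia. Qed.

(* Each Burge step maps j(F_i, F_(i+1)) to j(F_(i+1), F_(i+2)) and adds j^2 F_(i+1)^2 to the exponent;
   the squares add up by F_1^2 + ... + F_n^2 = F_n F_(n+1). *)
Lemma chain_sum q d N x y :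
  (Cmod q < 1)%R -> (y < N)%nat ->
  csum (map (chain q x y) (tuples d N))
  = cpow q (y * y)
    * sumC (fun j => theta_coef q q 1 j
        * (cpow q (fib (S d) * fib (S (S d)) * (j * j))
           * burge q x y (j * fib (S d)) (j * fib (S (S d))))) N.
Proof.
  intros Hq. revert x y. induction d as [|d IH]; intros x y Hy.
  - simpl tuples. unfold csum. cbn [map fold_right chain].
    rewrite (qbin_base q x y N) by easy.
    rewrite (sumC_ext (fun j => _ * (_ * burge q x y (j * _) _))
      (fun j => theta_coef q q 1 j * (cpow q (j * j) * burge q x y j j))); [ring|].
    intros j _. simpl fib. now rewrite !Nat.mul_1_r, !Nat.mul_1_l.
  - rewrite csum_tuples_S.
    rewrite (sumC_ext _ (fun z => cpow q (y * y) * sumC (fun j =>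
        (theta_coef q q 1 j * cpow q (fib (S d) * fib (S (S d)) * (j * j)))
        * (qbin q (Z.of_nat x + Z.of_nat y - Z.of_nat z) (2 * y)
           * (cpow q (z * z) * burge q y z (j * fib (S d)) (j * fib (S (S d)))))) N)).
    2:{ intros z Hz. cbn [chain]. rewrite !csum_scal, IH by easy.
        rewrite <- !sumC_scal. apply sumC_ext. intros. ring. }
    rewrite sumC_scal, sumC_swap. f_equal. apply sumC_ext. intros j _.
    rewrite sumC_scal, burge_transform
      by (try easy; apply Nat.mul_le_mono_l, fib_le_S).
    rewrite (fib_SS (S d)).
    replace (fib (S (S d)) * (fib (S (S d)) + fib (S d)) * (j * j))%nat
      with (fib (S d) * fib (S (S d)) * (j * j)
            + j * fib (S (S d)) * (j * fib (S (S d))))%nat by ring.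
    replace (j * (fib (S (S d)) + fib (S d)))%nat
      with (j * fib (S d) + j * fib (S (S d)))%nat by ring.
    rewrite cpow_add. ring.
Qed.

(** What remains over x = m_2 and a = m_1 once m_3 and all later variables are summed out, still
    over the square cut out by the box. *)
Definition bailey_box (q : C) (r N : nat) : C :=
  sumC (fun x => cpow q (x * x) * bailey_kernel q x r
                 * sumC (fun a => cpow q ((a + x) * (a + x)) * / qfac q a) N) N.

(** Here k = 5+d. [chain_sum] handles the variables after m_3, and [burge_transform_inf] handles
    m_3; the (q)_(2 m_2) it produces cancels the denominator of the summand. *)
Lemma lhs_box_theta q d N :
  (Cmod q < 1)%R ->
  lhs_box (5 + d) q N
  = sumC (fun j => theta_coef q q 1 j
      * (cpow q (fib (2 + d) * fib (3 + d) * (j * j))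
         * bailey_box q (j * fib (3 + d)) N)) N.
Proof.
  intros Hq. unfold lhs_box. replace (5 + d - 2)%nat with (S (S (S d))) by lia.
  rewrite csum_tuples_S.
  rewrite (sumC_ext _ (fun a => sumC (fun x => sumC (fun j =>
      theta_coef q q 1 j * cpow q (fib (2 + d) * fib (3 + d) * (j * j))
      * (cpow q (x * x) * bailey_kernel q x (j * fib (3 + d))
         * (cpow q ((a + x) * (a + x)) * / qfac q a))) N) N)).
  2:{ intros a _. rewrite csum_tuples_S. apply sumC_ext. intros x Hx.
      rewrite csum_tuples_S.
      rewrite (sumC_ext _ (fun y => sumC (fun j =>
          cpow q ((a + x) * (a + x)) * cpow q (x * x)
          * (/ qfac q a * / qfac q (2 * x)) * theta_coef q q 1 j
          * cpow q (fib (S d) * fib (S (S d)) * (j * j))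
          * (cpow q (y * y) * burge q x y (j * fib (S d)) (j * fib (S (S d))))) N)).
      2:{ intros y Hy.
          rewrite (map_ext_in _ (fun l => cpow q ((a + x) * (a + x)) * cpow q (x * x)
              * (/ qfac q a * / qfac q (2 * x)) * chain q x y l)).
          - rewrite csum_scal, chain_sum, <- !sumC_scal by easy.
            apply sumC_ext. intros. ring.
          - intros l Hl. apply lhs_term_chain; [easy|].
            now rewrite (tuples_length d N l Hl). }
      rewrite sumC_swap. apply sumC_ext. intros j _.
      rewrite sumC_scal, burge_transform_inf
        by (try easy; apply Nat.mul_le_mono_l, fib_le_S).
      change (fib (3 + d)) with (fib (S (S d)) + fib (S d))%nat.
      change (fib (2 + d)) with (fib (S (S d))).
      replace (fib (S (S d)) * (fib (S (S d)) + fib (S d)) * (j * j))%nat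
        with (fib (S d) * fib (S (S d)) * (j * j)
              + j * fib (S (S d)) * (j * fib (S (S d))))%nat by ring.
      replace (j * (fib (S (S d)) + fib (S d)))%nat
        with (j * fib (S d) + j * fib (S (S d)))%nat by ring.
      rewrite cpow_add. field. split; now apply qfac_neq. }
  rewrite sumC_swap.
  rewrite (sumC_ext _ (fun x => sumC (fun j => sumC (fun a =>
      theta_coef q q 1 j * cpow q (fib (2 + d) * fib (3 + d) * (j * j))
      * (cpow q (x * x) * bailey_kernel q x (j * fib (3 + d))
         * (cpow q ((a + x) * (a + x)) * / qfac q a))) N) N))
    by (intros; apply sumC_swap).
  rewrite sumC_swap. apply sumC_ext. intros j _. unfold bailey_box.
  rewrite <- !sumC_scal. apply sumC_ext. intros x _.
  rewrite <- !sumC_scal. apply sumC_ext. intros a _. ring.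
Qed.

(** * Limits of complex sequences *)

(** Stated through a real limit so that the theory of real sequences applies; [clim_filterlim]
    returns to the topology of C. *)
Definition clim (u : nat -> C) (l : C) : Prop :=
  is_lim_seq (fun n => Cmod (u n - l)) 0.

Lemma clim_eps u l :
  clim u l <->
  forall eps : R, (0 < eps)%R ->
    exists N, forall n, (N <= n)%nat -> (Cmod (u n - l) < eps)%R.
Proof.
  unfold clim. rewrite <- is_lim_seq_spec. split.
  - intros H eps Heps. destruct (H (mkposreal eps Heps)) as [N HN].
    exists N. intros n Hn. specialize (HN n Hn). simpl in HN.
    now rewrite Rminus_0_r, Rabs_pos_eq in HN by apply Cmod_ge_0.
  - intros H [eps Heps]. destruct (H eps Heps) as [N HN]. exists N.
    intros n Hn. simpl. rewrite Rminus_0_r, Rabs_pos_eq by apply Cmod_ge_0. auto.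
Qed.

Lemma clim_filterlim u l : clim u l -> filterlim u eventually (locally l).
Proof.
  intros H P [eps HP]. destruct (proj1 (clim_eps u l) H eps (cond_pos eps)) as [N HN].
  exists N. intros n Hn. apply HP. apply C_NormedModule_mixin_compat1. now apply HN.
Qed.

Lemma clim_squeeze (u : nat -> C) l (b : nat -> R) :
  (forall n, (Cmod (u n - l) <= b n)%R) -> is_lim_seq b 0 -> clim u l.
Proof.
  intros H Hb. apply (is_lim_seq_le_le (fun _ => 0%R) _ b).
  - intros n. split; [apply Cmod_ge_0|apply H].
  - apply is_lim_seq_const.
  - easy.
Qed.

Lemma clim_const c : clim (fun _ => c) c.
Proof.
  apply (clim_squeeze _ _ (fun _ => 0%R)); [|apply is_lim_seq_const].
  intros _. replace (c - c) with (RtoC 0) by ring. rewrite Cmod_0. lra.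
Qed.

Lemma clim_ext_loc (u v : nat -> C) l N :
  (forall n, (N <= n)%nat -> u n = v n) -> clim u l -> clim v l.
Proof.
  intros H. apply is_lim_seq_ext_loc. exists N. intros n Hn. now rewrite H.
Qed.

Lemma clim_ext (u v : nat -> C) l : (forall n, u n = v n) -> clim u l -> clim v l.
Proof. intros H. apply (clim_ext_loc u v l 0). auto. Qed.

Lemma clim_plus u v l m : clim u l -> clim v m -> clim (fun n => u n + v n) (l + m).
Proof.
  intros Hu Hv.
  apply (clim_squeeze _ _ (fun n => Cmod (u n - l) + Cmod (v n - m))%R).
  - intros n. replace (u n + v n - (l + m)) with ((u n - l) + (v n - m)) by ring.
    apply Cmod_triangle.
  - replace (Finite 0) with (Finite (0 + 0)) by (f_equal; ring).
    now apply is_lim_seq_plus'.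
Qed.

Lemma clim_mult u v l m : clim u l -> clim v m -> clim (fun n => u n * v n) (l * m).
Proof.
  intros Hu Hv.
  apply (clim_squeeze _ _ (fun n => Cmod (u n - l) * Cmod (v n - m)
    + (Cmod (u n - l) * Cmod m + Cmod l * Cmod (v n - m)))%R).
  - intros n.
    replace (u n * v n - l * m)
      with ((u n - l) * (v n - m) + ((u n - l) * m + l * (v n - m))) by ring.
    rewrite <- !Cmod_mult.
    eapply Rle_trans; [apply Cmod_triangle|]. apply Rplus_le_compat_l, Cmod_triangle.
  - replace (Finite 0) with (Finite (0 * 0 + (0 * Cmod m + Cmod l * 0)))
      by (f_equal; ring).
    apply is_lim_seq_plus'; [now apply is_lim_seq_mult'|].
    apply is_lim_seq_plus'; apply is_lim_seq_mult'; auto; apply is_lim_seq_const.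
Qed.

Lemma clim_scal c u l : clim u l -> clim (fun n => c * u n) (c * l).
Proof. intros H. apply clim_mult; [apply clim_const|easy]. Qed.

Lemma clim_Cmod u l : clim u l -> is_lim_seq (fun n => Cmod (u n)) (Cmod l).
Proof.
  intros H.
  apply (is_lim_seq_le_le (fun n => Cmod l - Cmod (u n - l))%R _
           (fun n => Cmod l + Cmod (u n - l))%R).
  - intros n. split.
    + pose proof (Cmod_triangle (u n) (l - u n)) as H1.
      replace (u n + (l - u n)) with l in H1 by ring.
      replace (l - u n) with (- (u n - l)) in H1 by ring. rewrite Cmod_opp in H1. lra.
    + pose proof (Cmod_triangle l (u n - l)) as H1.
      now replace (l + (u n - l)) with (u n) in H1 by ring.
  - replace (Finite (Cmod l)) with (Finite (Cmod l - 0)) by (f_equal; ring).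
    apply is_lim_seq_minus'; [apply is_lim_seq_const|easy].
  - replace (Finite (Cmod l)) with (Finite (Cmod l + 0)) by (f_equal; ring).
    apply is_lim_seq_plus'; [apply is_lim_seq_const|easy].
Qed.

Lemma clim_inv (u : nat -> C) (l : C) :
  (forall n, u n <> 0) -> l <> 0 -> clim u l -> clim (fun n => / u n) (/ l).
Proof.
  intros Hu Hl H.
  assert (Hl' : Cmod l <> 0%R) by (intros E; apply Hl, Cmod_eq_0, E).
  apply (clim_squeeze _ _ (fun n => Cmod (u n - l) * (/ Cmod (u n) * / Cmod l))%R).
  - intros n. replace (/ u n - / l) with (- ((u n - l) * (/ u n * / l)))
      by (field; auto).
    rewrite Cmod_opp, !Cmod_mult, !Cmod_inv by auto. lra.
  - replace (Finite 0) with (Finite (0 * (/ Cmod l * / Cmod l))) by (f_equal; ring).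
    apply is_lim_seq_mult'; [easy|]. apply is_lim_seq_mult'; [|apply is_lim_seq_const].
    apply (is_lim_seq_inv _ (Cmod l)); [now apply clim_Cmod|].
    intros E. apply Hl'. now inversion E.
Qed.

Lemma clim_unique (u : nat -> C) (l m : C) : clim u l -> clim u m -> l = m.
Proof.
  intros Hl Hm. apply Ceq_minus, Cmod_eq_0.
  assert (H : clim (fun n => u n + (- (1)) * u n) (l + (- (1)) * m))
    by (apply clim_plus; [easy|now apply clim_scal]).
  assert (H0 : clim (fun _ => 0) (l - m)).
  { replace (l - m) with (l + (- (1)) * m) by ring.
    revert H. apply clim_ext. intros n. ring. }
  apply clim_Cmod in H0. rewrite Cmod_0 in H0.
  apply is_lim_seq_unique in H0. rewrite Lim_seq_const in H0. now inversion H0.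
Qed.

Lemma clim_comp u l (phi : nat -> nat) :
  (forall M, exists N, forall n, (N <= n)%nat -> (M <= phi n)%nat) ->
  clim u l -> clim (fun n => u (phi n)) l.
Proof.
  intros Hphi H. apply clim_eps. intros eps Heps.
  destruct (proj1 (clim_eps u l) H eps Heps) as [M HM].
  destruct (Hphi M) as [N HN]. exists N. auto.
Qed.

Lemma clim_sumC (f : nat -> nat -> C) g J :
  (forall j, clim (fun n => f n j) (g j)) ->
  clim (fun n => sumC (f n) J) (sumC g J).
Proof.
  intros H. induction J as [|J IH]; simpl; [apply clim_const|]. now apply clim_plus.
Qed.

Lemma clim_of_re_im (u : nat -> C) (a b : R) :
  is_lim_seq (fun n => Re (u n)) a -> is_lim_seq (fun n => Im (u n)) b ->
  clim u (a, b).
Proof.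
  intros Ha Hb.
  apply (clim_squeeze _ _ (fun n => sqrt 2 * (Rabs (Re (u n) - a) + Rabs (Im (u n) - b)))%R).
  - intros n. eapply Rle_trans; [apply Cmod_2Rmax|].
    apply Rmult_le_compat_l; [apply sqrt_pos|].
    unfold Re, Im. simpl.
    pose proof (Rabs_pos (fst (u n) - a)). pose proof (Rabs_pos (snd (u n) - b)).
    apply Rmax_lub; unfold Rminus in *; lra.
  - replace (Finite 0) with (Finite (sqrt 2 * (Rabs (a - a) + Rabs (b - b)))).
    2:{ f_equal. rewrite !Rminus_diag, Rabs_R0. ring. }
    apply is_lim_seq_mult'; [apply is_lim_seq_const|].
    apply is_lim_seq_plus'; apply (is_lim_seq_abs _ (Finite _));
      apply is_lim_seq_minus'; auto; apply is_lim_seq_const.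
Qed.

Lemma sumC_geom_tail (f : nat -> C) c x J M :
  (0 <= x < 1)%R -> (forall i, (Cmod (f i) <= c * x ^ i)%R) -> (J <= M)%nat ->
  (Cmod (sumC f M - sumC f J) <= c / (1 - x) * x ^ J)%R.
Proof.
  intros Hx Hf HJM.
  assert (Hc : (0 <= c)%R).
  { specialize (Hf O). rewrite pow_O, Rmult_1_r in Hf.
    pose proof (Cmod_ge_0 (f O)). lra. }
  replace M with (J + (M - J))%nat by lia. generalize (M - J)%nat. intros m.
  (* The partial geometric sum is kept exactly, since the final bound alone would not pass through
     the induction on m. *)
  apply Rle_trans with (c / (1 - x) * (x ^ J - x ^ (J + m)))%R.
  - induction m as [|m IH].
    + rewrite Nat.add_0_r. replace (sumC f J - sumC f J) with (RtoC 0) by ring.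
      rewrite Cmod_0. lra.
    + rewrite Nat.add_succ_r. simpl sumC.
      replace (sumC f (J + m) + f (J + m)%nat - sumC f J)
        with ((sumC f (J + m) - sumC f J) + f (J + m)%nat) by ring.
      eapply Rle_trans; [apply Cmod_triangle|].
      eapply Rle_trans; [apply Rplus_le_compat; [apply IH|apply Hf]|].
      simpl pow. apply Req_le. field. lra.
  - apply Rmult_le_compat_l.
    + apply Rmult_le_pos; [easy|]. apply Rlt_le, Rinv_0_lt_compat. lra.
    + pose proof (pow_le x (J + m) (proj1 Hx)). lra.
Qed.

Lemma geom_small c x :
  (0 <= x < 1)%R -> forall eps, (0 < eps)%R ->
  exists N, forall n, (N <= n)%nat -> (c * x ^ n < eps)%R.
Proof.
  intros Hx eps Heps.
  assert (H : is_lim_seq (fun n => c * x ^ n)%R (c * 0)%R).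
  { apply is_lim_seq_mult'; [apply is_lim_seq_const|].
    apply is_lim_seq_geom. rewrite Rabs_pos_eq; lra. }
  apply is_lim_seq_spec in H. destruct (H (mkposreal eps Heps)) as [N HN].
  exists N. intros n Hn. specialize (HN n Hn). simpl in HN.
  apply Rabs_def2 in HN. lra.
Qed.

Lemma sumC_geom_converges (f : nat -> C) c x :
  (0 <= x < 1)%R -> (forall i, (Cmod (f i) <= c * x ^ i)%R) ->
  exists l, clim (sumC f) l.
Proof.
  intros Hx Hf.
  assert (HC : forall eps, (0 < eps)%R -> exists N, forall n m,
             (N <= n)%nat -> (N <= m)%nat -> (Cmod (sumC f n - sumC f m) < eps)%R).
  { intros eps Heps. destruct (geom_small (c / (1 - x)) x Hx eps Heps) as [N HN].
    exists N.
    assert (H : forall n m, (N <= m)%nat -> (m <= n)%nat ->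
                (Cmod (sumC f n - sumC f m) < eps)%R).
    { intros n m Hm Hmn. eapply Rle_lt_trans; [now apply sumC_geom_tail|auto]. }
    intros n m Hn Hm. destruct (Nat.le_ge_cases m n); [now apply H|].
    rewrite <- Cmod_opp, Copp_minus_distr. now apply H. }
  assert (HR : ex_finite_lim_seq (fun n => Re (sumC f n))).
  { apply ex_lim_seq_cauchy_corr. intros eps.
    destruct (HC eps (cond_pos eps)) as [N HN]. exists N. intros n m Hn Hm.
    eapply Rle_lt_trans; [|apply (HN n m Hn Hm)].
    change (Re (sumC f n) - Re (sumC f m))%R with (Re (sumC f n - sumC f m)).
    apply re_le_Cmod. }
  assert (HI : ex_finite_lim_seq (fun n => Im (sumC f n))).
  { apply ex_lim_seq_cauchy_corr. intros eps.
    destruct (HC eps (cond_pos eps)) as [N HN]. exists N. intros n m Hn Hm.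
    eapply Rle_lt_trans; [|apply (HN n m Hn Hm)].
    change (Im (sumC f n) - Im (sumC f m))%R with (Im (sumC f n - sumC f m)).
    eapply Rle_trans; [apply Rmax_r|apply Rmax_Cmod]. }
  destruct HR as [a Ha], HI as [b Hb]. exists (a, b). now apply clim_of_re_im.
Qed.

(** Dominated convergence when both the terms and the upper end depend on N: the geometric bound
    makes the tail beyond J small uniformly in N, and the first J terms converge one by one. *)
Lemma tannery (f : nat -> nat -> C) g (l : C) c x (phi : nat -> nat) :
  (0 <= x < 1)%R -> (forall N, (N <= phi N)%nat) ->
  (forall N j, (Cmod (f N j) <= c * x ^ j)%R) ->
  (forall j, clim (fun N => f N j) (g j)) -> clim (sumC g) l ->
  clim (fun N => sumC (f N) (phi N)) l.
Proof.
  intros Hx Hphi Hf Hlim Hl. apply clim_eps. intros eps Heps.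
  assert (He : (0 < eps / 3)%R) by lra.
  destruct (geom_small (c / (1 - x)) x Hx _ He) as [J1 HJ1].
  destruct (proj1 (clim_eps _ _) Hl _ He) as [J2 HJ2].
  set (J := Nat.max J1 J2).
  destruct (proj1 (clim_eps _ _) (clim_sumC f g J Hlim) _ He) as [N1 HN1].
  exists (Nat.max N1 J). intros N HN.
  replace (sumC (f N) (phi N) - l)
    with ((sumC (f N) (phi N) - sumC (f N) J)
          + ((sumC (f N) J - sumC g J) + (sumC g J - l))) by ring.
  eapply Rle_lt_trans; [apply Cmod_triangle|].
  assert (H1 : (Cmod (sumC (f N) (phi N) - sumC (f N) J) < eps / 3)%R).
  { eapply Rle_lt_trans; [apply (sumC_geom_tail _ c x); auto|apply HJ1; lia].
    specialize (Hphi N). lia. }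
  assert (H2 : (Cmod (sumC (f N) J - sumC g J) < eps / 3)%R) by (apply HN1; lia).
  assert (H3 : (Cmod (sumC g J - l) < eps / 3)%R) by (apply HJ2; lia).
  pose proof (Cmod_triangle (sumC (f N) J - sumC g J) (sumC g J - l)). lra.
Qed.

(** * The limit N -> infinity *)

Lemma Cmod_range (q : C) : (Cmod q < 1)%R -> (0 <= Cmod q < 1)%R.
Proof. intros H. split; [apply Cmod_ge_0|easy]. Qed.

Lemma pow_le_of_le x m n : (0 <= x < 1)%R -> (m <= n)%nat -> (x ^ n <= x ^ m)%R.
Proof.
  intros Hx H. replace n with (m + (n - m))%nat by lia. rewrite pow_add.
  rewrite <- (Rmult_1_r (x ^ m)) at 2.
  apply Rmult_le_compat_l; [apply pow_le; lra|].
  rewrite <- (pow1 (n - m)). apply pow_incr. lra.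
Qed.

Lemma Cmod_cpow_le q m n :
  (Cmod q < 1)%R -> (m <= n)%nat -> (Cmod (cpow q n) <= Cmod q ^ m)%R.
Proof. intros Hq H. rewrite Cmod_cpow. now apply pow_le_of_le; [apply Cmod_range|]. Qed.

Lemma Cmod_cpow_le_1 q n : (Cmod q < 1)%R -> (Cmod (cpow q n) <= 1)%R.
Proof. intros Hq. apply (Cmod_cpow_le q 0 n Hq). lia. Qed.

Lemma exp_le_exp a b : (a <= b)%R -> (exp a <= exp b)%R.
Proof. intros [H| ->]; [now apply Rlt_le, exp_increasing|lra]. Qed.

(** With t = |q|^(n+1), use 1+t <= e^t and 1/(1-t) = 1 + t/(1-t) <= e^(t/(1-t)), where t <= |q|.
    Exponential bounds turn the product (q)_n into a geometric sum in the exponent, and one bound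
    serves for the factor and its inverse. *)
Lemma Cmod_one_minus_cpow q n :
  (Cmod q < 1)%R ->
  (Cmod (1 - cpow q (S n)) <= exp (Cmod q ^ S n / (1 - Cmod q)))%R /\
  (Cmod (/ (1 - cpow q (S n))) <= exp (Cmod q ^ S n / (1 - Cmod q)))%R.
Proof.
  intros Hq. pose proof (Cmod_range q Hq) as Hx.
  set (t := (Cmod q ^ S n)%R). set (x := Cmod q) in *.
  assert (Ht : (0 <= t <= x)%R).
  { split; [apply pow_le; lra|]. rewrite <- (pow_1 x). apply pow_le_of_le; [easy|lia]. }
  assert (Hb : (t <= t / (1 - t) <= t / (1 - x))%R).
  { split.
    - rewrite <- (Rmult_1_r t) at 1. apply Rmult_le_compat_l; [lra|].
      rewrite <- Rinv_1 at 1. apply Rinv_le_contravar; lra.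
    - apply Rmult_le_compat_l; [lra|]. apply Rinv_le_contravar; lra. }
  assert (Hm : Cmod (cpow q (S n)) = t) by apply Cmod_cpow.
  split.
  - eapply Rle_trans; [apply Cmod_triangle|]. rewrite Cmod_opp, Cmod_1, Hm.
    eapply Rle_trans; [apply exp_ineq1_le|]. apply exp_le_exp. lra.
  - rewrite Cmod_inv by now apply one_minus_cpow_neq.
    assert (H1 : (1 - t <= Cmod (1 - cpow q (S n)))%R).
    { pose proof (Cmod_triangle (1 - cpow q (S n)) (cpow q (S n))) as H.
      replace (1 - cpow q (S n) + cpow q (S n)) with (RtoC 1) in H by ring.
      rewrite Cmod_1, Hm in H. lra. }
    apply Rle_trans with (/ (1 - t))%R; [apply Rinv_le_contravar; lra|].
    replace (/ (1 - t))%R with (1 + t / (1 - t))%R by (field; lra).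
    eapply Rle_trans; [apply exp_ineq1_le|]. apply exp_le_exp. lra.
Qed.

Lemma qfac_bounded q :
  (Cmod q < 1)%R ->
  exists K, (1 <= K)%R /\
    (forall n, (Cmod (qfac q n) <= K)%R) /\ (forall n, (Cmod (/ qfac q n) <= K)%R).
Proof.
  intros Hq. pose proof (Cmod_range q Hq) as Hx. set (x := Cmod q) in *.
  (* The sum of |q|^i / (1-|q|) over 1 <= i <= n. *)
  set (s := fun n => (x * (1 - x ^ n) / (1 - x) / (1 - x))%R).
  assert (Hinv : (0 < / (1 - x))%R) by (apply Rinv_0_lt_compat; lra).
  assert (Hs : forall n, (s n <= x / (1 - x) / (1 - x))%R).
  { intros n. unfold s, Rdiv. do 2 (apply Rmult_le_compat_r; [lra|]).
    pose proof (pow_le x n (proj1 Hx)). nra. }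
  assert (H : forall n, (Cmod (qfac q n) <= exp (s n))%R /\
                        (Cmod (/ qfac q n) <= exp (s n))%R).
  { induction n as [|n [IH1 IH2]].
    - unfold s. change (qfac q 0) with (RtoC 1).
      replace (x * (1 - x ^ 0) / (1 - x) / (1 - x))%R with 0%R by (simpl; field; lra).
      replace (/ RtoC 1) with (RtoC 1) by field. rewrite Cmod_1, exp_0. lra.
    - replace (s (S n)) with (s n + x ^ S n / (1 - x))%R
        by (unfold s; simpl; field; lra).
      destruct (Cmod_one_minus_cpow q n Hq) as [H1 H2].
      rewrite exp_plus, qfac_S.
      replace (/ (qfac q n * (1 - cpow q (S n))))
        with (/ qfac q n * / (1 - cpow q (S n)))
        by (field; split; auto using one_minus_cpow_neq, qfac_neq).
      rewrite !Cmod_mult.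
      split; apply Rmult_le_compat; auto using Cmod_ge_0. }
  exists (exp (x / (1 - x) / (1 - x))). repeat split.
  - apply Rle_trans with (exp 0); [rewrite exp_0; lra|].
    apply exp_le_exp. unfold Rdiv.
    apply Rmult_le_pos; [apply Rmult_le_pos|]; lra.
  - intros n. eapply Rle_trans; [apply H|]. now apply exp_le_exp.
  - intros n. eapply Rle_trans; [apply H|]. now apply exp_le_exp.
Qed.

(** Since (q)_(n+1) - (q)_n = -(q)_n q^(n+1), the sequence is a geometrically dominated series; the
    uniform bound on 1/(q)_n keeps its limit away from 0. *)
Lemma qfac_limit q :
  (Cmod q < 1)%R -> exists P : C, P <> 0 /\ clim (qfac q) P.
Proof.
  intros Hq. destruct (qfac_bounded q Hq) as (K & HK & H1 & H2).
  pose proof (Cmod_range q Hq) as Hx.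
  destruct (sumC_geom_converges (fun i => - (qfac q i * cpow q (S i))) K (Cmod q) Hx)
    as [l Hl].
  { intros i. rewrite Cmod_opp, Cmod_mult.
    apply Rmult_le_compat; auto using Cmod_ge_0. apply Cmod_cpow_le; [easy|lia]. }
  exists (1 + l).
  assert (HP : clim (qfac q) (1 + l)).
  { apply (clim_ext (fun n => 1 + sumC (fun i => - (qfac q i * cpow q (S i))) n)).
    - induction n as [|n IH]; [simpl; unfold qfac; simpl; ring|].
      rewrite qfac_S, <- IH at 1. cbn [sumC]. rewrite <- IH. ring.
    - apply clim_plus; [apply clim_const|easy]. }
  split; [|easy]. intros E. rewrite E in HP.
  assert (HK' : (0 < / K)%R) by (apply Rinv_0_lt_compat; lra).
  destruct (proj1 (clim_eps _ _) HP _ HK') as [N HN]. specialize (HN N (le_n N)).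
  replace (qfac q N - 0) with (qfac q N) in HN by ring. specialize (H2 N).
  rewrite Cmod_inv in H2 by now apply qfac_neq.
  assert (Hp : (0 < Cmod (qfac q N))%R) by now apply Cmod_gt_0, qfac_neq.
  apply Rinv_lt_contravar in HN; [|apply Rmult_lt_0_compat; lra].
  rewrite Rinv_inv in HN. lra.
Qed.

Lemma Cmod_rqfac_le q n j K :
  (0 <= K)%R -> (forall n, (Cmod (/ qfac q n) <= K)%R) -> (Cmod (rqfac q n j) <= K)%R.
Proof.
  intros HK H. unfold rqfac. destruct (Nat.leb j n); [easy|]. now rewrite Cmod_0.
Qed.

Lemma Cmod_bailey_kernel_le q n r K :
  (0 <= K)%R -> (forall n, (Cmod (/ qfac q n) <= K)%R) ->
  (Cmod (bailey_kernel q n r) <= K * K)%R.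
Proof.
  intros HK H. unfold bailey_kernel. rewrite Cmod_mult.
  apply Rmult_le_compat; auto using Cmod_ge_0, Cmod_rqfac_le.
Qed.

Lemma qfac_inv_limit (q P : C) :
  (Cmod q < 1)%R -> P <> 0 -> clim (qfac q) P -> clim (fun n => / qfac q n) (/ P).
Proof. intros Hq HP. apply clim_inv; auto using qfac_neq. Qed.

Lemma rqfac_limit (q P : C) (j : nat) :
  (Cmod q < 1)%R -> P <> 0 -> clim (qfac q) P -> clim (fun n => rqfac q n j) (/ P).
Proof.
  intros Hq HP H. apply (clim_ext_loc (fun n => / qfac q (n - j)) _ _ j).
  - intros n Hn. now rewrite rqfac_in.
  - apply (clim_comp (fun n => / qfac q n)); [|now apply qfac_inv_limit].
    intros M. exists (M + j)%nat. lia.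
Qed.

Lemma bailey_kernel_limit (q P : C) (r : nat) :
  (Cmod q < 1)%R -> P <> 0 -> clim (qfac q) P ->
  clim (fun n => bailey_kernel q n r) (/ P * / P).
Proof.
  intros Hq HP H. apply clim_mult; [now apply rqfac_limit|].
  apply (clim_comp (fun n => / qfac q n)); [|now apply qfac_inv_limit].
  intros M. exists M. lia.
Qed.

Lemma le_square n : (n <= n * n)%nat.
Proof. nia. Qed.

Lemma Cmod_mult_le a b x y :
  (Cmod a <= x)%R -> (Cmod b <= y)%R -> (Cmod (a * b) <= x * y)%R.
Proof. intros. rewrite Cmod_mult. apply Rmult_le_compat; auto using Cmod_ge_0. Qed.

(* [bailey_sum] with n = p tending to infinity. *)
Lemma durfee_sum (q P : C) (r : nat) :
  (Cmod q < 1)%R -> P <> 0 -> clim (qfac q) P ->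
  clim (sumC (fun t => cpow q (t * t) * bailey_kernel q t r)) (cpow q (r * r) * / P).
Proof.
  intros Hq HP H. destruct (qfac_bounded q Hq) as (K & HK & _ & HI).
  pose proof (Cmod_range q Hq) as Hx.
  destruct (sumC_geom_converges (fun t => cpow q (t * t) * bailey_kernel q t r)
              (K * K) (Cmod q) Hx) as [D HD].
  { intros i. rewrite Rmult_comm. apply Cmod_mult_le.
    - apply Cmod_cpow_le; [easy|apply le_square].
    - apply Cmod_bailey_kernel_le; [lra|easy]. }
  replace (cpow q (r * r) * / P) with D; [easy|].
  set (f := fun A t => cpow q (t * t) * bailey_kernel q t r
                       * (rqfac q A t * rqfac q A t)).
  (* Two evaluations of one limit: termwise it is D/P^2, and through [bailey_sum] with n = p = A it
     is q^(r^2)/P^3. *)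
  assert (H1 : clim (fun A => sumC (f A) (S A)) (D * (/ P * / P))).
  { apply (tannery f (fun t => cpow q (t * t) * bailey_kernel q t r * (/ P * / P))
             _ (K * K * (K * K)) (Cmod q) S); auto.
    - intros N j. unfold f.
      replace (K * K * (K * K) * Cmod q ^ j)%R
        with (Cmod q ^ j * (K * K) * (K * K))%R by ring.
      apply Cmod_mult_le; [apply Cmod_mult_le|].
      + apply Cmod_cpow_le; [easy|apply le_square].
      + apply Cmod_bailey_kernel_le; [lra|easy].
      + apply Cmod_mult_le; apply Cmod_rqfac_le; auto; lra.
    - intros j. apply clim_scal. apply clim_mult; now apply rqfac_limit.
    - apply (clim_ext (fun n => sumC (fun t => cpow q (t * t) * bailey_kernel q t r) n
                                * (/ P * / P))).
      + intros n. now rewrite <- sumC_scal_r.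
      + apply clim_mult; [easy|apply clim_const]. }
  assert (H2 : clim (fun A => sumC (f A) (S A))
                 (cpow q (r * r) * P * ((/ P * / P) * (/ P * / P)))).
  { apply (clim_ext (fun A => cpow q (r * r) * qfac q (A + A)
                              * (bailey_kernel q A r * bailey_kernel q A r))).
    - intros A. rewrite <- (bailey_sum q A A r (S A)) by (auto; lia).
      apply sumC_ext. intros. unfold f. ring.
    - apply clim_mult; [|apply clim_mult; now apply bailey_kernel_limit].
      apply clim_scal. apply (clim_comp (qfac q)); [|easy].
      intros M. exists M. lia. }
  pose proof (clim_unique _ _ _ H1 H2) as E.
  apply (Cmult_reg_l (/ P * / P)).
  - intros E0. apply HP. transitivity (P * P * P * (/ P * / P)); [field; easy|].
    rewrite E0. ring.
  - transitivity (D * (/ P * / P)); [ring|]. rewrite E. field. easy.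
Qed.

Lemma sumC_S (f : nat -> C) n : sumC f (S n) = sumC f n + f n.
Proof. reflexivity. Qed.

Lemma sumC_triangle (h : nat -> nat -> C) N :
  sumC (fun x => sumC (h x) (N - x)) N
  = sumC (fun n => sumC (fun x => h x (n - x)%nat) (S n)) N.
Proof.
  induction N as [|N IH]; [easy|].
  rewrite (sumC_S _ N), (sumC_S (fun n => sumC _ (S n)) N), <- IH.
  replace (S N - N)%nat with 1%nat by lia.
  rewrite (sumC_ext (fun x => sumC (h x) (S N - x))
             (fun x => sumC (h x) (N - x) + h x (N - x)%nat)).
  2:{ intros i Hi. now replace (S N - i)%nat with (S (N - i)) by lia. }
  rewrite sumC_plus, (sumC_S (fun x => h x (N - x)%nat) N), Nat.sub_diag.
  cbn [sumC]. ring.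
Qed.

Definition bailey_inner (q : C) (x N : nat) : C :=
  sumC (fun a => cpow q ((a + x) * (a + x)) * / qfac q a) N.

(** Since (a+x)^2 >= a+x, the bound splits into geometric factors in a and in x; the factor in x
    later makes the outer sum converge. *)
Lemma bailey_inner_term q K x a :
  (Cmod q < 1)%R -> (forall n, (Cmod (/ qfac q n) <= K)%R) ->
  (Cmod (cpow q ((a + x) * (a + x)) * / qfac q a)
   <= K * Cmod q ^ x * Cmod q ^ a)%R.
Proof.
  intros Hq HI.
  replace (K * Cmod q ^ x * Cmod q ^ a)%R with (Cmod q ^ (x + a) * K)%R
    by (rewrite pow_add; ring).
  apply Cmod_mult_le; [|easy]. apply Cmod_cpow_le; [easy|nia].
Qed.

Lemma bailey_inner_le q K x N :
  (Cmod q < 1)%R -> (forall n, (Cmod (/ qfac q n) <= K)%R) ->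
  (Cmod (bailey_inner q x N) <= K / (1 - Cmod q) * Cmod q ^ x)%R.
Proof.
  intros Hq HI.
  pose proof (sumC_geom_tail (fun a => cpow q ((a + x) * (a + x)) * / qfac q a)
    (K * Cmod q ^ x) (Cmod q) 0 N (Cmod_range q Hq)
    (fun a => bailey_inner_term q K x a Hq HI) (Nat.le_0_l N)) as H.
  unfold bailey_inner. simpl in H.
  replace (sumC _ N - 0)
    with (sumC (fun a => cpow q ((a + x) * (a + x)) * / qfac q a) N) in H by ring.
  eapply Rle_trans; [exact H|]. apply Req_le. unfold Rdiv. ring.
Qed.

Lemma bailey_box_term q K r x (u : C) c :
  (Cmod q < 1)%R -> (1 <= K)%R -> (forall n, (Cmod (/ qfac q n) <= K)%R) ->
  (Cmod u <= c * Cmod q ^ x)%R ->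
  (Cmod (cpow q (x * x) * bailey_kernel q x r * u) <= K * K * c * Cmod q ^ x)%R.
Proof.
  intros Hq HK HI Hu.
  replace (K * K * c * Cmod q ^ x)%R with (1 * (K * K) * (c * Cmod q ^ x))%R by ring.
  apply Cmod_mult_le; [|easy]. apply Cmod_mult_le.
  - now apply Cmod_cpow_le_1.
  - apply Cmod_bailey_kernel_le; [lra|easy].
Qed.

(** Uniformity in r is essential: r is a multiple of j, and the bound dominates the sum over j. *)
Lemma bailey_box_bounded q :
  (Cmod q < 1)%R -> exists B, forall r N, (Cmod (bailey_box q r N) <= B)%R.
Proof.
  intros Hq. destruct (qfac_bounded q Hq) as (K & HK & _ & HI).
  exists (K * K * (K / (1 - Cmod q)) / (1 - Cmod q) * 1)%R. intros r N.
  pose proof (sumC_geom_tail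
    (fun x => cpow q (x * x) * bailey_kernel q x r * bailey_inner q x N)
    (K * K * (K / (1 - Cmod q))) (Cmod q) 0 N (Cmod_range q Hq)) as H.
  unfold bailey_box. simpl in H.
  replace (sumC _ N - 0)
    with (sumC (fun x => cpow q (x * x) * bailey_kernel q x r * bailey_inner q x N) N)
    in H by ring.
  apply H; [|lia]. intros x. apply bailey_box_term; auto. now apply bailey_inner_le.
Qed.

(** On the diagonals n = a+x of the triangle the factor q^((a+x)^2) is constant and 1/(q)_a =
    1/(q)_(n-x), so the sum along each diagonal is [bailey_sum_inf], without any limit. *)
Lemma bailey_triangle q r N :
  (Cmod q < 1)%R ->
  sumC (fun x => cpow q (x * x) * bailey_kernel q x r * bailey_inner q x (N - x)) N
  = cpow q (r * r) * sumC (fun n => cpow q (n * n) * bailey_kernel q n r) N.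
Proof.
  intros Hq. unfold bailey_inner.
  rewrite (sumC_ext _ (fun x => sumC (fun a => cpow q (x * x) * bailey_kernel q x r
      * (cpow q ((a + x) * (a + x)) * / qfac q a)) (N - x)))
    by (intros; now rewrite sumC_scal).
  rewrite (sumC_triangle (fun x a => cpow q (x * x) * bailey_kernel q x r
      * (cpow q ((a + x) * (a + x)) * / qfac q a))).
  rewrite <- sumC_scal. apply sumC_ext. intros n _.
  rewrite (sumC_ext _ (fun x => cpow q (n * n)
      * (cpow q (x * x) * (rqfac q n x * bailey_kernel q x r)))).
  - rewrite sumC_scal, bailey_sum_inf by (auto; lia). ring.
  - intros x Hx. rewrite rqfac_in by lia.
    replace (n - x + x)%nat with n by lia. ring.
Qed.

(** The square is split into the triangle and a remainder [f]. For fixed x the remainder is a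
    difference of two partial sums of one convergent series, so it tends to 0 by dominated
    convergence; the triangle gives q^(r^2) times [durfee_sum]. *)
Lemma bailey_box_limit (q P : C) (r : nat) :
  (Cmod q < 1)%R -> P <> 0 -> clim (qfac q) P ->
  clim (bailey_box q r) (cpow q (2 * (r * r)) * / P).
Proof.
  intros Hq HP H. destruct (qfac_bounded q Hq) as (K & HK & _ & HI).
  pose proof (Cmod_range q Hq) as Hx.
  set (c := fun x => cpow q (x * x) * bailey_kernel q x r).
  set (f := fun N x => c x * (bailey_inner q x N - bailey_inner q x (N - x))).
  assert (H0 : clim (fun N => sumC (f N) N) 0).
  { apply (tannery f (fun _ => 0) 0 (K * K * (2 * (K / (1 - Cmod q)))) (Cmod q)
             (fun N => N)); auto.
    - intros N x. apply bailey_box_term; auto.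
      eapply Rle_trans; [apply Cmod_triangle|]. rewrite Cmod_opp.
      pose proof (bailey_inner_le q K x N Hq HI).
      pose proof (bailey_inner_le q K x (N - x) Hq HI). lra.
    - intros x.
      destruct (sumC_geom_converges (fun a => cpow q ((a + x) * (a + x)) * / qfac q a)
                  (K * Cmod q ^ x) (Cmod q) Hx) as [U HU].
      { intros a. now apply bailey_inner_term. }
      replace (RtoC 0) with (c x * (U + - (1) * U)) by ring.
      apply clim_scal.
      apply (clim_ext (fun n => bailey_inner q x n + - (1) * bailey_inner q x (n - x))).
      { intros n. ring. }
      apply clim_plus; [exact HU|]. apply clim_scal.
      apply (clim_comp (bailey_inner q x)); [|exact HU].
      intros M. exists (M + x)%nat. lia.
    - apply (clim_ext (fun _ => 0)); [|apply clim_const].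
      intros n. symmetry. now apply sumC_zero. }
  replace (2 * (r * r))%nat with (r * r + r * r)%nat by lia. rewrite cpow_add.
  replace (cpow q (r * r) * cpow q (r * r) * / P)
    with (0 + cpow q (r * r) * (cpow q (r * r) * / P)) by ring.
  apply (clim_ext (fun N => sumC (f N) N
     + cpow q (r * r) * sumC (fun n => cpow q (n * n) * bailey_kernel q n r) N)).
  - intros N. rewrite <- bailey_triangle, <- sumC_plus by easy. unfold bailey_box.
    apply sumC_ext. intros x _. unfold f, c, bailey_inner. ring.
  - apply clim_plus; [easy|]. apply clim_scal. now apply durfee_sum.
Qed.

(** * The theta series and the product side *)

(** With t = j(j-1)/2 and 2t + j = j^2, (2a+1)t + aj = t + a j^2: the base q^(2a+1) absorbs the
    quadratic factor that the left side attaches to the theta series. *)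
Lemma theta_coef_square q a j :
  theta_coef (cpow q (2 * a + 1)) (cpow q a) (cpow q (a + 1)) j
  = theta_coef q q 1 j * cpow q (a * (j * j)).
Proof.
  destruct j as [|j]; [simpl; rewrite Nat.mul_0_r; simpl; ring|].
  cbn [theta_coef]. unfold theta_sym. rewrite <- !cpow_mul, cpow_1.
  rewrite <- (tri_double (S j)). set (t := tri (S j)). generalize (S j). intros m.
  replace ((2 * a + 1) * t)%nat with (a * (2 * t) + t)%nat by ring.
  replace ((a + 1) * m)%nat with (a * m + m)%nat by ring.
  rewrite Nat.mul_add_distr_l, !cpow_add. ring.
Qed.

Lemma Cmod_theta_coef_le q j : (Cmod q < 1)%R -> (Cmod (theta_coef q q 1 j) <= 2)%R.
Proof.
  intros Hq. destruct j as [|j]; [simpl; rewrite Cmod_1; lra|].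
  cbn [theta_coef]. unfold theta_sym. generalize (S j) as m. intros m.
  replace 2%R with (1 * 1 * 2)%R by ring.
  apply Cmod_mult_le; [apply Cmod_mult_le|].
  - rewrite Cmod_cpow, Cmod_opp, Cmod_1, pow1. lra.
  - now apply Cmod_cpow_le_1.
  - rewrite cpow_1. eapply Rle_trans; [apply Cmod_triangle|]. rewrite Cmod_1.
    pose proof (Cmod_cpow_le_1 q m Hq). lra.
Qed.

Lemma Cmod_theta_term_le q a j :
  (Cmod q < 1)%R -> (1 <= a)%nat ->
  (Cmod (theta_coef q q 1 j * cpow q (a * (j * j))) <= 2 * Cmod q ^ j)%R.
Proof.
  intros Hq Ha. apply Cmod_mult_le; [now apply Cmod_theta_coef_le|].
  apply Cmod_cpow_le; [easy|nia].
Qed.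

(** With Q = q^(2a+1), the finite triple product handles the first two factors; [2n; n-j] in base Q
    tends to 1/(Q;Q)_infinity, which the third factor cancels in the limit. *)
Lemma rhs_limit (q : C) a (P T : C) :
  (Cmod q < 1)%R -> (1 <= a)%nat -> P <> 0 -> clim (qfac q) P ->
  clim (sumC (fun j => theta_coef q q 1 j * cpow q (a * (j * j)))) T ->
  clim (fun n => qpoch (cpow q a) (cpow q (2 * a + 1)) n
                 * qpoch (cpow q (a + 1)) (cpow q (2 * a + 1)) n
                 * qpoch (cpow q (2 * a + 1)) (cpow q (2 * a + 1)) n / qpoch q q n)
    (T * / P).
Proof.
  intros Hq Ha HP HPl HS. set (Q := cpow q (2 * a + 1)).
  assert (HQ : (Cmod Q < 1)%R).
  { eapply Rle_lt_trans; [apply (Cmod_cpow_le q 1); [easy|lia]|lra]. }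
  destruct (qfac_limit Q HQ) as (R0 & HR & HRl).
  destruct (qfac_bounded Q HQ) as (K & HK & HF & HI).
  assert (Hw : forall j, clim (fun n => central_qbin Q n j) (/ R0)).
  { intros j. replace (/ R0) with (R0 * (/ R0 * / R0)) by (field; easy).
    apply (clim_ext (fun n => qfac Q (2 * n) * bailey_kernel Q n j)).
    - intros n. unfold central_qbin, bailey_kernel. ring.
    - apply clim_mult; [|now apply bailey_kernel_limit].
      apply (clim_comp (qfac Q)); [|easy]. intros M. exists M. lia. }
  assert (Hsum : clim (fun n => sumC (fun j => theta_coef q q 1 j * cpow q (a * (j * j))
                                    * central_qbin Q n j) (S n)) (T * / R0)).
  { apply (tannery _ (fun j => theta_coef q q 1 j * cpow q (a * (j * j)) * / R0) _
             (2 * (K * (K * K))) (Cmod q) S (Cmod_range q Hq)); auto.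
    - intros N j.
      replace (2 * (K * (K * K)) * Cmod q ^ j)%R
        with (2 * Cmod q ^ j * (K * (K * K)))%R by ring.
      apply Cmod_mult_le; [now apply Cmod_theta_term_le|].
      unfold central_qbin. rewrite <- Cmult_assoc.
      apply Cmod_mult_le; [easy|]. apply Cmod_bailey_kernel_le; [lra|easy].
    - intros j. now apply clim_scal.
    - apply (clim_ext (fun n =>
        sumC (fun j => theta_coef q q 1 j * cpow q (a * (j * j))) n * / R0)).
      + intros n. now rewrite <- sumC_scal_r.
      + apply clim_mult; [easy|apply clim_const]. }
  replace (T * / P) with (T * / R0 * R0 * / P) by (field; easy).
  apply clim_mult; [|now apply qfac_inv_limit]. apply clim_mult; [|easy].
  revert Hsum. apply clim_ext. intros n. symmetry.
  rewrite (finite_jacobi_triple Q (cpow q a) (cpow q (a + 1)) n (S n)).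
  - apply sumC_ext. intros j _. unfold Q. now rewrite theta_coef_square.
  - easy.
  - unfold Q. rewrite <- cpow_add. f_equal. lia.
  - lia.
Qed.

Lemma fib_pos n : (1 <= fib (S n))%nat.
Proof. induction n as [|n IH]; [simpl; lia|]. pose proof (fib_le_S n). lia. Qed.

Theorem theorem1p6 (q : C) (k : nat) :
  (Cmod q < 1)%R -> (5 <= k)%nat ->
  exists L : C,
    filterlim (lhs_box k q) eventually (locally L) /\
    filterlim (rhs_partial k q) eventually (locally L).
Proof.
  intros Hq Hk. set (d := (k - 5)%nat). replace k with (5 + d)%nat by (unfold d; lia).
  destruct (qfac_limit q Hq) as (P & HP & HPl).
  pose proof (Cmod_range q Hq) as Hx.
  set (a := (fib (5 + d) * fib (3 + d))%nat).
  assert (Ha : (1 <= a)%nat)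
    by exact (Nat.mul_le_mono 1 _ 1 _ (fib_pos (4 + d)) (fib_pos (2 + d))).
  (* T is the theta series, known only to converge; both sides are compared with T/P. *)
  destruct (sumC_geom_converges _ 2 (Cmod q) Hx
              (fun j => Cmod_theta_term_le q a j Hq Ha)) as [T HS].
  exists (T * / P). split; apply clim_filterlim.
  - destruct (bailey_box_bounded q Hq) as [B HB].
    apply (clim_ext _ _ _ (fun N => eq_sym (lhs_box_theta q d N Hq))).
    apply (tannery _ (fun j => theta_coef q q 1 j * cpow q (a * (j * j)) * / P) _
             (2 * B) (Cmod q) (fun N => N) Hx); auto.
    + intros N j. rewrite Cmult_assoc.
      replace (2 * B * Cmod q ^ j)%R with (2 * Cmod q ^ j * B)%R by ring.
      apply Cmod_mult_le; [|easy]. apply Cmod_theta_term_le; [easy|].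
      exact (Nat.mul_le_mono 1 _ 1 _ (fib_pos (1 + d)) (fib_pos (2 + d))).
    + intros j. rewrite <- Cmult_assoc. apply clim_scal.
      (* From F_(5+d) = 2 F_(3+d) + F_(2+d): the Burge steps contribute F_(2+d) F_(3+d) and the two
         Bailey sums 2 F_(3+d)^2, together F_(3+d) F_(5+d). *)
      replace (a * (j * j))%nat
        with (fib (2 + d) * fib (3 + d) * (j * j)
              + 2 * (j * fib (3 + d) * (j * fib (3 + d))))%nat.
      * rewrite cpow_add, <- Cmult_assoc. apply clim_scal. now apply bailey_box_limit.
      * unfold a. change (fib (5 + d))
          with (fib (3 + d) + fib (2 + d) + fib (3 + d))%nat. ring.
    + apply (clim_ext (fun n =>
        sumC (fun j => theta_coef q q 1 j * cpow q (a * (j * j))) n * / P)).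
      * intros n. now rewrite <- sumC_scal_r.
      * apply clim_mult; [easy|apply clim_const].
  - unfold rhs_partial. replace (5 + d - 2)%nat with (3 + d)%nat by lia.
    fold a. now apply rhs_limit.
Qed.
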